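(* Let $p\in\mathbb H$, $R_2>R_1>0$, and let $f$ be a left slice hyperholomorphic function on an axially symmetric open set containing the Cassini shell $U(p,R_1,R_2)$, where it admits a spherical Laurent expansion $$f(q)=\sum_{n\in\mathbb Z}Q_p^n(q)\,[a_{2n}+(q-p)a_{2n+1}],\qquad a_n\in\mathbb H,$$ absolutely and uniformly convergent on the compact subsets of $U(p,R_1,R_2)$. Then $\breve f=\Delta f$ has, for $q\in U(p,R_1,R_2)$, the expansion $$\breve f(q)=\Delta f(q)=-16(q_0-p_0)^2\sum_{n\in\mathbb Z}\mathcal C_n(q,p)[a_{2n}+(q-p)a_{2n+1}]-8(q_0-p_0)\sum_{n\in\mathbb Z}\mathcal L_n(q,p)a_{2n+1}-4\sum_{n\in\mathbb Z}n\,Q_p^{n-1}(q)[a_{2n}+(q-p)a_{2n+1}].$$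
   Context: $\mathbb H$ denotes the quaternions $q=q_0+q_1e_1+q_2e_2+q_3e_3$ with the usual relations, $\underline q=q_1e_1+q_2e_2+q_3e_3$, $\bar q=q_0-\underline q$, $\mathbb S=\{\underline q:|\underline q|=1\}$, $[q]=\{q_0+I|\underline q|:I\in\mathbb S\}$; a set $U$ is axially symmetric if $[q]\subset U$ for all $q\in U$. Slice hyperholomorphic: for $U$ axially symmetric open and $\mathcal U=\{(u,v)\in\mathbb R^2:u+\mathbb Sv\subset U\}$, $f:U\to\mathbb H$ is left slice hyperholomorphic if $f(u+Iv)=\alpha(u,v)+I\beta(u,v)$ for all $(u,v)\in\mathcal U$, $I\in\mathbb S$, with $C^1$ functions $\alpha,\beta:\mathcal U\to\mathbb H$, $\alpha$ even and $\beta$ odd in $v$, satisfying $\partial_u\alpha=\partial_v\beta$, $\partial_v\alpha=-\partial_u\beta$. $\Delta=\sum_{i=0}^3\partial_{q_i}^2$ in the variable $q$. $p_0=\mathrm{Re}(p)$; $Q_p(q)=q^2-2p_0q+|p|^2$, $Q_p^n(q)=(Q_p(q))^n$ for $n\in\mathbb Z$. Absolute and uniform convergence of the spherical Laurent expansion refers to both series $\sum_{n\in\mathbb Z}Q_p^n(q)a_{2n}$ and $\sum_{n\in\mathbb Z}Q_p^n(q)(q-p)a_{2n+1}$. The Cassini shell is $U(p,R_1,R_2)=\{q\in\mathbb H:R_1^2<|Q_p(q)|<R_2^2\}$. For $q\in\mathbb H\setminus[p]$, $$\mathcal L_n(q,p)=\begin{cases}\sum_{k=0}^{n-1}\overline{Q_p^{\,n-1-k}(q)}\,Q_p^k(q),&n\ge1,\\0,&n=0,\\-\sum_{k=0}^{|n|-1}\overline{Q_p^{-k-1}(q)}\,Q_p^{k+n}(q),&n\le-1,\end{cases}$$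 $$\mathcal C_n(q,p)=\begin{cases}\sum_{k=0}^{n-2}(k+1)\,\overline{Q_p^{\,n-2-k}(q)}\,Q_p^k(q),&n\ge2,\\0,&n=0,1,\\\sum_{k=0}^{|n|-1}(|n|-k)\,Q_p^{k+n-1}(q)\,\overline{Q_p^{-k-1}(q)},&n\le-1.\end{cases}$$ *)

(* Defs.v *)
From HB Require Import structures.
From mathcomp Require Import all_boot all_order all_algebra.
From mathcomp Require Import all_classical all_reals all_analysis.
From mathcomp Require Import ring lra.

Set Implicit Arguments.
Unset Strict Implicit.
Unset Printing Implicit Defensive.

Import Order.TTheory GRing.Theory Num.Theory.
Import numFieldNormedType.Exports.

Local Open Scope classical_set_scope.
Local Open Scope ring_scope.

Record quat (R : Type) := Quat { qre : R; qi : R; qj : R; qk : R }.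

Section QuatAlgebra.
Context {R : realType}.
Implicit Types (x y z : quat R) (a b : R).

Definition quat_tuple x : R * R * R * R := (qre x, qi x, qj x, qk x).
Definition quat_of_tuple (t : R * R * R * R) : quat R :=
  Quat t.1.1.1 t.1.1.2 t.1.2 t.2.
Lemma quat_tupleK : cancel quat_tuple quat_of_tuple.
Proof. by case. Qed.
HB.instance Definition _ := Choice.copy (quat R) (can_type quat_tupleK).

Definition addq x y :=
  Quat (qre x + qre y) (qi x + qi y) (qj x + qj y) (qk x + qk y).
Definition oppq x := Quat (- qre x) (- qi x) (- qj x) (- qk x).
Definition mulq x y := Quat
  (qre x * qre y - qi x * qi y - qj x * qj y - qk x * qk y)
  (qre x * qi y + qi x * qre y + qj x * qk y - qk x * qj y)
  (qre x * qj y - qi x * qk y + qj x * qre y + qk x * qi y)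
  (qre x * qk y + qi x * qj y - qj x * qi y + qk x * qre y).
Definition scaleq a x := Quat (a * qre x) (a * qi x) (a * qj x) (a * qk x).
Definition conjq x := Quat (qre x) (- qi x) (- qj x) (- qk x).
Definition sqnormq x := qre x ^+ 2 + qi x ^+ 2 + qj x ^+ 2 + qk x ^+ 2.
Definition invq x := scaleq (sqnormq x)^-1 (conjq x).

Fact addqA : associative addq.
Proof. by move=> [? ? ? ?] [? ? ? ?] [? ? ? ?]; rewrite /addq /= !addrA. Qed.
Fact addqC : commutative addq.
Proof. by move=> [? ? ? ?] [? ? ? ?]; congr Quat => /=; rewrite addrC. Qed.
Fact add0q : left_id (Quat 0 0 0 0) addq.
Proof. by move=> [? ? ? ?]; rewrite /addq /= !add0r. Qed.
Fact addNq : left_inverse (Quat 0 0 0 0) oppq addq.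
Proof. by move=> [? ? ? ?]; rewrite /addq /= !addNr. Qed.
HB.instance Definition _ := GRing.isZmodule.Build (quat R) addqA addqC add0q addNq.

Fact mulqA : associative mulq.
Proof. by move=> [????] [????] [????]; congr Quat => /=; ring. Qed.
Fact mul1q : left_id (Quat 1 0 0 0) mulq.
Proof. by move=> [????]; congr Quat => /=; ring. Qed.
Fact mulq1 : right_id (Quat 1 0 0 0) mulq.
Proof. by move=> [????]; congr Quat => /=; ring. Qed.
Fact mulqDl : left_distributive mulq +%R.
Proof. by move=> [????] [????] [????]; congr Quat => /=; ring. Qed.
Fact mulqDr : right_distributive mulq +%R.
Proof. by move=> [????] [????] [????]; congr Quat => /=; ring. Qed.
Fact oneq_neq0 : Quat 1 0 0 0 != 0 :> quat R.
Proof. by apply/eqP => -[] /eqP; rewrite oner_eq0. Qed.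
HB.instance Definition _ :=
  GRing.Zmodule_isNzRing.Build (quat R) mulqA mul1q mulq1 mulqDl mulqDr oneq_neq0.

Fact scaleqA a b x : scaleq a (scaleq b x) = scaleq (a * b) x.
Proof. by congr Quat => /=; rewrite mulrA. Qed.
Fact scale1q : left_id 1 scaleq.
Proof. by move=> [????]; rewrite /scaleq /= !mul1r. Qed.
Fact scaleqDr : right_distributive scaleq +%R.
Proof. by move=> ? ? ?; congr Quat => /=; rewrite mulrDr. Qed.
Fact scaleqDl x : {morph scaleq^~ x : a b / a + b}.
Proof. by move=> ? ?; congr Quat => /=; rewrite mulrDl. Qed.
HB.instance Definition _ :=
  GRing.Zmodule_isLmodule.Build R (quat R) scaleqA scale1q scaleqDr scaleqDl.

Fact scaleqAl a x y : a *: (x * y) = (a *: x) * y.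
Proof. by congr Quat => /=; ring. Qed.
HB.instance Definition _ := GRing.Lmodule_isLalgebra.Build R (quat R) scaleqAl.
Fact scaleqAr a x y : a *: (x * y) = x * (a *: y).
Proof. by congr Quat => /=; ring. Qed.
HB.instance Definition _ := GRing.Lalgebra_isAlgebra.Build R (quat R) scaleqAr.

Lemma sqnormq_ge0 x : 0 <= sqnormq x.
Proof. by rewrite /sqnormq !addr_ge0 ?sqr_ge0. Qed.

Lemma sqnormq_eq0 x : (sqnormq x == 0) = (x == 0).
Proof.
apply/eqP/eqP => [|->]; last by rewrite /sqnormq /= expr0n /= !addr0.
case: x => a b c d; rewrite /sqnormq /= => h.
have [[[ha hb] hc] hd] := (sqr_ge0 a, sqr_ge0 b, sqr_ge0 c, sqr_ge0 d).
have a0 : a = 0 by apply/eqP; rewrite -sqrf_eq0; apply/eqP; lra.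
have b0 : b = 0 by apply/eqP; rewrite -sqrf_eq0; apply/eqP; lra.
have c0 : c = 0 by apply/eqP; rewrite -sqrf_eq0; apply/eqP; lra.
have d0 : d = 0 by apply/eqP; rewrite -sqrf_eq0; apply/eqP; lra.
by rewrite a0 b0 c0 d0; congr Quat.
Qed.

Fact mulVq : {in [pred x | x != 0], left_inverse 1 invq *%R}.
Proof.
move=> x; rewrite inE -sqnormq_eq0 => x0.
by congr Quat => /=; move: x0; rewrite /sqnormq => x0; field.
Qed.
Fact mulqV : {in [pred x | x != 0], right_inverse 1 invq *%R}.
Proof.
move=> x; rewrite inE -sqnormq_eq0 => x0.
by congr Quat => /=; move: x0; rewrite /sqnormq => x0; field.
Qed.
Fact unitqP x y : y * x = 1 /\ x * y = 1 -> [pred x | x != 0] x.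
Proof.
by case=> _ xy /=; apply: contra_eq_neq xy => ->; rewrite mul0r eq_sym oner_eq0.
Qed.
Fact invq_out : {in [predC [pred x | x != 0]], invq =1 id}.
Proof.
move=> x; rewrite !inE negbK => /eqP ->.
by congr Quat => /=; rewrite ?oppr0 mulr0.
Qed.
HB.instance Definition _ :=
  GRing.NzRing_hasMulInverse.Build (quat R) mulVq mulqV unitqP invq_out.

Definition normq x := Num.sqrt (sqnormq x).

Fact ler_normqD x y : normq (x + y) <= normq x + normq y.
Proof.
rewrite -ler_sqr ?nnegrE ?addr_ge0 ?sqrtr_ge0//.
rewrite sqrrD !sqr_sqrtr ?sqnormq_ge0//.
pose d := qre x * qre y + qi x * qi y + qj x * qj y + qk x * qk y.
have -> : sqnormq (x + y) = sqnormq x + d *+ 2 + sqnormq y.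
  by rewrite /sqnormq /d /=; ring.
rewrite lerD2r lerD2l lerMn2r /= -sqrtrM ?sqnormq_ge0//.
apply: le_trans (ler_norm d) _; rewrite -sqrtr_sqr ler_sqrt; last first.
  by rewrite mulr_ge0 ?sqnormq_ge0.
rewrite -subr_ge0.
have -> : sqnormq x * sqnormq y - d ^+ 2 =
    (qre x * qi y - qi x * qre y) ^+ 2 + (qre x * qj y - qj x * qre y) ^+ 2 +
    (qre x * qk y - qk x * qre y) ^+ 2 + (qi x * qj y - qj x * qi y) ^+ 2 +
    (qi x * qk y - qk x * qi y) ^+ 2 + (qj x * qk y - qk x * qj y) ^+ 2.
  by rewrite /sqnormq /d; ring.
by rewrite !addr_ge0 ?sqr_ge0.
Qed.
Fact normqZ a x : normq (a *: x) = `|a| * normq x.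
Proof.
have sqnormqZ : sqnormq (a *: x) = a ^+ 2 * sqnormq x.
  by rewrite /sqnormq /=; ring.
by rewrite /normq sqnormqZ sqrtrM ?sqr_ge0// sqrtr_sqr.
Qed.
Fact normq0_eq0 x : normq x = 0 -> x = 0.
Proof.
move/eqP; rewrite sqrtr_eq0 => x0; apply/eqP.
by rewrite -sqnormq_eq0 eq_le x0 sqnormq_ge0.
Qed.
HB.instance Definition _ :=
  Lmodule_isNormed.Build R (quat R) ler_normqD normqZ normq0_eq0.

Definition e1 : quat R := Quat 0 1 0 0.
Definition e2 : quat R := Quat 0 0 1 0.
Definition e3 : quat R := Quat 0 0 0 1.

Definition vecq x : quat R := Quat 0 (qi x) (qj x) (qk x).

End QuatAlgebra.

Section TwoSidedSeries.
Context {R : realType} {V : normedModType R}.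

(* A series indexed by the integers converges when its parts over n >= 0 and
   over n <= -1 both converge; recall that Negz n stands for -(n+1). *)
Definition zcvg (u : int -> V) : Prop :=
  cvgn (series (u \o Posz)) /\ cvgn (series (u \o Negz)).

Definition zlim (u : int -> V) : V :=
  limn (series (u \o Posz)) + limn (series (u \o Negz)).

Definition zcvg_to (u : int -> V) (s : V) : Prop := zcvg u /\ s = zlim u.

End TwoSidedSeries.

Definition zcvg_abs {R : realType} {V : normedModType R} (u : int -> V) : Prop :=
  zcvg (fun n => `|u n| : R).

Definition zcvg_unif {R : realType} {T : choiceType} {V : normedModType R}
    (K : set T) (u : int -> T -> V) : Prop :=
  exists g h : T -> V,
    {uniform K, (fun N x => series (fun n => u (Posz n) x) N) @ \oo --> g} /\
    {uniform K, (fun N x => series (fun n => u (Negz n) x) N) @ \oo --> h}.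

Section SliceHyperholomorphic.
Context {R : realType}.
Local Notation H := (quat R).

Definition unit_sphere : set H := [set I | qre I = 0 /\ `|I| = 1].

Definition sphere_of (q : H) : set H :=
  [set (qre q)%:A + `|vecq q| *: I | I in unit_sphere].

Definition axially_symmetric (U : set H) : Prop :=
  forall q, U q -> sphere_of q `<=` U.

Definition slice_domain (U : set H) : set (R * R) :=
  [set w | forall I, unit_sphere I -> U (w.1%:A + w.2 *: I)].

(* To be used on open sets D, on which the partial derivatives at a point of D
   and their continuity there depend only on the restriction of g to D. *)
Definition C1_on (D : set (R * R)) (g : R * R -> H) : Prop :=
  forall w, D w ->
    [/\ derivable g w (1, 0), derivable g w (0, 1),
        {for w, continuous ('D_(1, 0) g)} & {for w, continuous ('D_(0, 1) g)}].

Definition left_slice_hyperholomorphic (U : set H) (f : H -> H) : Prop :=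
  exists alpha beta : R * R -> H,
    [/\ C1_on (slice_domain U) alpha, C1_on (slice_domain U) beta,
        (forall u v, slice_domain U (u, v) ->
          alpha (u, - v) = alpha (u, v) /\ beta (u, - v) = - beta (u, v)),
        (forall w, slice_domain U w ->
          'D_(1, 0) alpha w = 'D_(0, 1) beta w /\
          'D_(0, 1) alpha w = - 'D_(1, 0) beta w) &
        (forall u v I, slice_domain U (u, v) -> unit_sphere I ->
          f (u%:A + v *: I) = alpha (u, v) + I * beta (u, v))].

Definition quat_basis : seq H := [:: 1; e1; e2; e3].

Definition laplacian (f : H -> H) (q : H) : H :=
  \sum_(e <- quat_basis) 'D_e ('D_e f) q.

(* 'D_e is a total operator; this asserts that every derivative occurring in
   the Laplacian at q exists. *)
Definition has_laplacian (f : H -> H) (q : H) : Prop :=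
  forall e, e \in quat_basis ->
    (\forall x \near q, derivable f x e) /\ derivable ('D_e f) q e.

End SliceHyperholomorphic.

Section Cassini.
Context {R : realType}.
Local Notation H := (quat R).
Implicit Types (p q : H) (n : int).

Definition Qp p q : H := q ^+ 2 - (2 * qre p) *: q + (`|p| ^+ 2)%:A.

Definition cassini_shell p (R1 R2 : R) : set H :=
  [set q | R1 ^+ 2 < `|Qp p q| < R2 ^+ 2].

Definition calL n q p : H :=
  if 1 <= n then
    \sum_(k < `|n|) conjq (Qp p q ^ (n - 1 - k%:Z)) * Qp p q ^ k%:Z
  else if n == 0 then 0
  else - \sum_(k < `|n|) conjq (Qp p q ^ (- k%:Z - 1)) * Qp p q ^ (k%:Z + n).

Definition calC n q p : H :=
  if 2 <= n then
    \sum_(k < `|n|.-1)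
      k.+1%:R *: (conjq (Qp p q ^ (n - 2 - k%:Z)) * Qp p q ^ k%:Z)
  else if 0 <= n then 0
  else \sum_(k < `|n|)
    (`|n| - k)%:R *:
      (Qp p q ^ (k%:Z + n - 1) * conjq (Qp p q ^ (- k%:Z - 1))).

Definition laurent_coef (a : int -> H) p q n : H :=
  a (2 * n) + (q - p) * a (2 * n + 1).

(* Absolute and uniform convergence are required of the two series with
   coefficients a_(2n) and a_(2n+1) separately. *)
Definition spherical_laurent_expansion
    (f : H -> H) (a : int -> H) p (R1 R2 : R) : Prop :=
  [/\ forall q, cassini_shell p R1 R2 q ->
        zcvg_to (fun n => Qp p q ^ n * laurent_coef a p q n) (f q),
      forall q, cassini_shell p R1 R2 q ->
        zcvg_abs (fun n => Qp p q ^ n * a (2 * n)) /\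
        zcvg_abs (fun n => Qp p q ^ n * (q - p) * a (2 * n + 1)) &
      forall K : set H, compact K -> K `<=` cassini_shell p R1 R2 ->
        zcvg_unif K (fun n q => Qp p q ^ n * a (2 * n)) /\
        zcvg_unif K (fun n q => Qp p q ^ n * (q - p) * a (2 * n + 1))].

End Cassini.

(* Main.v *)
(* Only the Laurent series matters. On the shell |Q_p| takes every value of
   ]R1^2, R2^2[, at points other than p, so absolute convergence makes the terms
   r^n |a_(2n)| and r^n |a_(2n+1)| summable for every r in that interval, with room
   to absorb the factor n^2 produced by two differentiations. Derivatives of the
   noncommutative powers Q_p^n are Lipschitz with summable constants, hence the
   series can be differentiated term by term twice in each basis direction e.

   The Laplacian of each term reduces to two identities. Writing Q_e for the
   derivative of Q_p in direction e and d = q_0 - p_0, every x commuting with q has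
     sum_e Q_e x Q_e = - 8 d^2 conj(x)   and   sum_e Q_e x e = - 4 d conj(x).
   Expanding the derivative of Q_p^n as sum_k Q_p^k Q_e Q_p^(n-1-k), the first one
   gives - 8 d^2 L_n for the cross terms of the second derivative and the
   recursion C_(n+1) = L_n + Q_p C_n, and the second one the term in a_(2n+1).
   Negative powers are powers of W = Q_p^(-1), with derivative - W Q_e W. *)

Require Import Defs.
From mathcomp Require Import all_boot all_order all_algebra.
From mathcomp Require Import all_classical all_reals all_analysis.
From mathcomp Require Import ring lra zify.
Import Order.TTheory GRing.Theory Num.Theory.
Import numFieldNormedType.Exports.
Local Open Scope classical_set_scope.
Local Open Scope ring_scope.

Set Implicit Arguments.
Unset Strict Implicit.
Unset Printing Implicit Defensive.

(** * Quaternion algebra and the derivatives of the Cassini polynomial *)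

Section QuaternionAlgebra.
Context {R : realType}.
Local Notation H := (quat R).
Implicit Types x y p q e : H.

Lemma quatP x y : qre x = qre y -> qi x = qi y -> qj x = qj y -> qk x = qk y ->
  x = y.
Proof. by case: x y => [????] [????] /= -> -> -> ->. Qed.

Lemma quat_normE x : `|x| = Defs.normq x. Proof. by []. Qed.

Lemma normq_sqr x : `|x| ^+ 2 = sqnormq x :> R.
Proof. by rewrite quat_normE sqr_sqrtr// sqnormq_ge0. Qed.

Lemma sqnormqM x y : sqnormq (x * y) = sqnormq x * sqnormq y.
Proof. by rewrite /sqnormq /=; ring. Qed.

Lemma normqM x y : `|x * y| = `|x| * `|y| :> R.
Proof. by rewrite !quat_normE /Defs.normq sqnormqM sqrtrM// sqnormq_ge0. Qed.

Lemma normq1 : `|1 : H| = 1 :> R.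
Proof.
by rewrite quat_normE /Defs.normq /sqnormq /= expr0n /= expr1n !addr0 sqrtr1.
Qed.

Lemma normqX x n : `|x ^+ n| = `|x| ^+ n :> R.
Proof. by elim: n => [|n IH]; rewrite ?expr0 ?normq1// !exprS normqM IH. Qed.

Lemma quat_unitE x : (x \is a GRing.unit) = (x != 0). Proof. by []. Qed.

Lemma normqV x : `|x^-1| = `|x|^-1 :> R.
Proof.
have [->|x0] := eqVneq x 0; first by rewrite invr0 !normr0 invr0.
apply: (mulfI (_ : (`|x| : R) != 0)); first by rewrite normr_eq0.
by rewrite -normqM !divrr ?normq1// ?unitfE ?normr_eq0 ?quat_unitE.
Qed.

Lemma conjqM x y : conjq (x * y) = conjq y * conjq x.
Proof. by apply: quatP => /=; ring. Qed.

Lemma conjqX x n : conjq (x ^+ n) = conjq x ^+ n.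
Proof.
elim: n => [|n IH]; first by apply: quatP => /=; rewrite ?oppr0.
by rewrite exprS conjqM IH exprSr.
Qed.

Lemma normq_conj x : `|conjq x| = `|x| :> R.
Proof. by rewrite !quat_normE /Defs.normq /sqnormq /=; congr Num.sqrt; ring. Qed.

Lemma comm_conjq x : GRing.comm x (conjq x).
Proof. by apply: quatP => /=; ring. Qed.

Lemma conjqV x : conjq x^-1 = (conjq x)^-1.
Proof.
have [->|x0] := eqVneq x 0; last first.
  have c0 : conjq x != 0 by rewrite -normr_eq0 normq_conj normr_eq0.
  apply: (mulrI (_ : conjq x \is a GRing.unit)); first by rewrite quat_unitE.
  rewrite divrr ?quat_unitE// -conjqM mulVr ?quat_unitE//.
  by apply: quatP => /=; rewrite ?oppr0.
have -> : conjq (0 : H) = 0 by apply: quatP => /=; rewrite ?oppr0.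
by rewrite invr0; apply: quatP => /=; rewrite ?oppr0.
Qed.

(** The two products stay separate because [e] need not commute with [q]; for commuting [e] they
    merge into the usual derivative of a quadratic polynomial. *)
Definition dQp p q e : H := q * e + e * q - (2 * qre p) *: e.

Lemma big_quat_basis (F : H -> H) :
  \sum_(e <- quat_basis) F e = F 1 + F e1 + F e2 + F e3.
Proof. by rewrite /quat_basis !big_cons big_nil addr0 !addrA. Qed.

(** For arbitrary [x] a computation in components leaves the extra term
    [4 *: (vecq q * (x * q - q * x))], and commutation with [q] is exactly what kills it. *)
Lemma sum_dQp_sandwich p q x : GRing.comm x q ->
  \sum_(e <- quat_basis) dQp p q e * x * dQp p q e =
  - (8 * (qre q - qre p) ^+ 2) *: conjq x.
Proof.
move=> xq; rewrite big_quat_basis.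
transitivity (- (8 * (qre q - qre p) ^+ 2) *: conjq x
              + 4 *: (vecq q * (x * q - q * x))).
  by apply: quatP => /=; ring.
by rewrite xq subrr mulr0 scaler0 addr0.
Qed.

Lemma sum_dQp_mul p q x : GRing.comm x q ->
  \sum_(e <- quat_basis) dQp p q e * x * e =
  - (4 * (qre q - qre p)) *: conjq x.
Proof.
move=> xq; rewrite big_quat_basis.
transitivity (- (4 * (qre q - qre p)) *: conjq x + 2 *: (q * x - x * q)).
  by apply: quatP => /=; ring.
by rewrite xq subrr scaler0 addr0.
Qed.

Lemma sum_basis_sqr : \sum_(e <- quat_basis) 2 *: (e * e) = (- 4)%:A :> H.
Proof. by rewrite big_quat_basis; apply: quatP => /=; ring. Qed.

Lemma comm_Qp p q : GRing.comm (Qp p q) q.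
Proof.
apply: commr_sym; rewrite /Qp; apply: commrD; first apply: commrB.
- exact: commrX.
- by rewrite /GRing.comm -scalerAl -scalerAr.
- by rewrite /GRing.comm mulr_algl mulr_algr.
Qed.

(* First and second derivatives of [b ^+ n], where [b1] and [b2] stand for those
   of [b]. *)
Fixpoint dpow (b b1 : H) n : H :=
  if n is m.+1 then b1 * b ^+ m + b * dpow b b1 m else 0.
Fixpoint d2pow (b b1 b2 : H) n : H :=
  if n is m.+1 then b2 * b ^+ m + 2 *: (b1 * dpow b b1 m) + b * d2pow b b1 b2 m
  else 0.

Lemma dpowE b b1 n : dpow b b1 n = \sum_(k < n) b ^+ k * b1 * b ^+ (n - k.+1).
Proof.
elim: n => [|n IH]; first by rewrite big_ord0.
rewrite /= big_ord_recl /= expr0 mul1r subn1 /= IH mulr_sumr; congr (_ + _).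
by apply: eq_bigr => k _; rewrite !mulrA -exprS subSS.
Qed.

End QuaternionAlgebra.

(** * The kernels as basis sums of derivatives of powers, and their norm bounds *)

Section CassiniKernels.
Context {R : realType}.
Local Notation H := (quat R).
Implicit Types (x y p q e : H) (a : R).

Definition dQpV p q e : H := - ((Qp p q)^-1 * dQp p q e * (Qp p q)^-1).
(** Differentiating either outer inverse of [dQpV] gives the same product, whence the factor 2;
    [2 *: (e * e)] is the derivative of [dQp p q e]. *)
Definition d2QpV p q e : H :=
  2 *: ((Qp p q)^-1 * dQp p q e * (Qp p q)^-1 * dQp p q e * (Qp p q)^-1)
  - (Qp p q)^-1 * (2 *: (e * e)) * (Qp p q)^-1.

(** Here and in the next three lemmas integer exponents become natural powers of [Qp p q] or of its
    inverse. The truncated subtractions are exact, as the range of [k] keeps them nonnegative. *)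
Lemma calL_Posz n q p :
  calL (Posz n) q p = \sum_(k < n) conjq (Qp p q) ^+ (n - k.+1) * Qp p q ^+ k.
Proof.
case: n => [|n]; first by rewrite /calL /= big_ord0.
rewrite /calL /=; apply: eq_bigr => k _; have kn := ltn_ord k.
rewrite -exprnP; congr (_ * _).
have -> : n.+1%:Z - 1 - k%:Z = (n.+1 - k.+1)%N by lia.
by rewrite -exprnP conjqX.
Qed.

Lemma calL_Negz n q p :
  calL (Negz n) q p =
  - \sum_(k < n.+1) (conjq (Qp p q))^-1 ^+ k.+1 * (Qp p q)^-1 ^+ (n.+1 - k).
Proof.
rewrite /calL /=; congr (- _); apply: eq_bigr => k _; have kn := ltn_ord k.
have -> : - k%:Z - 1 = - (k.+1%:Z) by lia.
have -> : k%:Z + Negz n = - ((n.+1 - k)%N%:Z) by lia.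
by rewrite -!exprnN -!exprVn conjqX conjqV.
Qed.

Lemma calC_Posz n q p :
  calC (Posz n) q p =
  \sum_(k < n.-1) k.+1%:R *: (conjq (Qp p q) ^+ (n - k.+2) * Qp p q ^+ k).
Proof.
case: n => [|[|n]]; try by rewrite /calC /= big_ord0.
rewrite /calC /=; apply: eq_bigr => k _; have kn := ltn_ord k.
rewrite -exprnP; congr (_ *: (_ * _)).
have -> : n.+2%:Z - 2 - k%:Z = (n.+2 - k.+2)%N by lia.
by rewrite -exprnP conjqX.
Qed.

Lemma calC_Negz n q p :
  calC (Negz n) q p =
  \sum_(k < n.+1) (n.+1 - k)%:R *:
    ((Qp p q)^-1 ^+ (n.+2 - k) * (conjq (Qp p q))^-1 ^+ k.+1).
Proof.
rewrite /calC /=; apply: eq_bigr => k _; have kn := ltn_ord k.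
have -> : - k%:Z - 1 = - (k.+1%:Z) by lia.
have -> : k%:Z + Negz n - 1 = - ((n.+2 - k)%N%:Z) by lia.
by rewrite -!exprnN -!exprVn conjqX conjqV.
Qed.

(** This order of summation fits the cross terms of the second derivative, where the power caught
    between the two factors [dQp], hence conjugated, has exponent [k]. *)
Lemma calL_Posz_rev n q p :
  calL (Posz n) q p = \sum_(k < n) conjq (Qp p q) ^+ k * Qp p q ^+ (n - k.+1).
Proof.
rewrite calL_Posz (reindex_inj rev_ord_inj) /=; apply: eq_bigr => k _.
by congr (_ ^+ _ * _); have := ltn_ord k; lia.
Qed.

Lemma calL_Negz_rev n q p :
  calL (Negz n) q p =
  - \sum_(k < n.+1) (conjq (Qp p q))^-1 ^+ (n.+1 - k) * (Qp p q)^-1 ^+ k.+1.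
Proof.
rewrite calL_Negz (reindex_inj rev_ord_inj) /=; congr (- _).
apply: eq_bigr => k _.
by congr (_ ^+ _ * _ ^+ _); have := ltn_ord k; lia.
Qed.

(** In each summand of [dpowE] the left power comes out of the sum over [e]; the right power
    commutes with [q], so [sum_dQp_mul] conjugates it. *)
Lemma sum_dpow_mul p q n :
  \sum_(e <- quat_basis) dpow (Qp p q) (dQp p q e) n * e =
  - (4 * (qre q - qre p)) *: calL (Posz n) q p.
Proof.
under eq_bigr do rewrite dpowE mulr_suml.
rewrite exchange_big /= calL_Posz scaler_sumr; apply: eq_bigr => k _.
under eq_bigr do rewrite -!mulrA [dQp _ _ _ * _]mulrA.
rewrite -mulr_sumr sum_dQp_mul; last exact/commr_sym/commrX/commr_sym/comm_Qp.
rewrite conjqX -scalerAr; congr (_ *: _).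
exact/commr_sym/commrX/commr_sym/commrX/comm_conjq.
Qed.


Lemma comm_QpV p q : GRing.comm (Qp p q)^-1 q.
Proof. exact/commr_sym/commrV/commr_sym/comm_Qp. Qed.

Lemma sum_dpowV_mul p q n :
  \sum_(e <- quat_basis) dpow (Qp p q)^-1 (dQpV p q e) n.+1 * e =
  - (4 * (qre q - qre p)) *: calL (Negz n) q p.
Proof.
under eq_bigr do rewrite dpowE mulr_suml.
rewrite exchange_big /= calL_Negz_rev -sumrN scaler_sumr; apply: eq_bigr => k _.
set W := (Qp p q)^-1; have kn := ltn_ord k.
(* The two inverses around [dQp] in [dQpV] are absorbed by the neighbouring powers [W ^+ k] and
   [W ^+ (n - k)]. *)
transitivity (- (W ^+ k.+1 * \sum_(e <- quat_basis) dQp p q e * W ^+ (n.+1 - k) * e)).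
  rewrite mulr_sumr -sumrN; apply: eq_bigr => e _.
  rewrite /dQpV -/W mulrN !mulNr; congr (- _).
  by rewrite exprSr subSS subSn// exprS !mulrA.
rewrite sum_dQp_mul; last exact/commr_sym/commrX/commr_sym/comm_QpV.
rewrite conjqX conjqV -scalerAr scalerN; congr (- (_ *: _)).
apply/commrX/commr_sym/commrX/commrV/commr_sym/commrV/comm_conjq.
Qed.

(** Split the weight [k.+1] as [1 + k]: the ones add up to [calL], while the part weighted by [k]
    loses its first term and releases a factor [Qp p q]. *)
Lemma calC_PoszS p q n :
  calC (Posz n.+1) q p = calL (Posz n) q p + Qp p q * calC (Posz n) q p.
Proof.
rewrite !calC_Posz calL_Posz /=; case: n => [|n] /=.
  by rewrite !big_ord0 mulr0 addr0.
rewrite big_ord_recl [in RHS]big_ord_recl /= scale1r -addrA; congr (_ + _).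
rewrite mulr_sumr -big_split /=; apply: eq_bigr => k _.
rewrite /bump /= !add1n !subSS -scalerAr mulrA.
have -> : Qp p q * conjq (Qp p q) ^+ (n - k.+1) * Qp p q ^+ k =
    conjq (Qp p q) ^+ (n - k.+1) * Qp p q ^+ k.+1.
  by rewrite exprS mulrA (commrX _ (comm_conjq (Qp p q))).
by rewrite -[k.+2]add1n natrD scalerDl scale1r.
Qed.

(** Induction along the recursion of [d2pow]: its first summand contributes [- 4 *: Qp p q ^+ n],
    its doubled cross term a multiple of [calL], which [calC_PoszS] combines with the induction
    hypothesis. *)
Lemma sum_d2pow p q n :
  \sum_(e <- quat_basis) d2pow (Qp p q) (dQp p q e) (2 *: (e * e)) n =
  - (16 * (qre q - qre p) ^+ 2) *: calC (Posz n) q p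
  - 4 *: (n%:R *: Qp p q ^+ n.-1).
Proof.
elim: n => [|n IH].
  by rewrite big1// calC_Posz big_ord0 scaler0 scale0r scaler0 subr0.
rewrite /= !big_split /= -mulr_sumr IH -mulr_suml sum_basis_sqr -scaler_sumr.
have -> : \sum_(e <- quat_basis) dQp p q e * dpow (Qp p q) (dQp p q e) n =
    - (8 * (qre q - qre p) ^+ 2) *: calL (Posz n) q p.
  under eq_bigr do rewrite dpowE mulr_sumr.
  rewrite exchange_big /= calL_Posz_rev scaler_sumr; apply: eq_bigr => k _.
  under eq_bigr do rewrite !mulrA.
  rewrite -mulr_suml sum_dQp_sandwich; last exact/commr_sym/commrX/commr_sym/comm_Qp.
  by rewrite conjqX -scalerAl.
rewrite calC_PoszS; move: ((qre q - qre p) ^+ 2) => c.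
rewrite mulrBr -!scalerAr scalerDr mulr_algl.
(* For [n = 0] the truncated exponent is off by one, but the scalar vanishes. *)
have -> : n%:R *: (Qp p q * Qp p q ^+ n.-1) = n%:R *: Qp p q ^+ n.
  by case: n {IH} => [|n]; rewrite -?exprS ?scale0r.
set A := calL _ _ _; set B := Qp p q * _; set X := Qp p q ^+ n.
rewrite -[n.+1]add1n natrD; move: A B X => A B X; apply: quatP => /=; ring.
Qed.

(** The weights split as [1 + (n.+1 - k)]. The term [k = 0] of the unweighted sum is kept apart
    because it comes from the second derivative of [W], whereas the others come from the cross
    terms. *)
Lemma calC_NegzS p q n :
  let W := (Qp p q)^-1 in
  calC (Negz n.+1) q p = W ^+ n.+3 * conjq W
    + \sum_(k < n.+1) conjq W ^+ k.+2 * W ^+ (n.+2 - k) + W * calC (Negz n) q p.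
Proof.
move=> W; rewrite !calC_Negz -!conjqV -/W.
have cW j k : GRing.comm (conjq W ^+ j) (W ^+ k).
  exact/commrX/commr_sym/commrX/comm_conjq.
transitivity (\sum_(k < n.+2) W ^+ (n.+3 - k) * conjq W ^+ k.+1
   + \sum_(k < n.+2) (n.+1 - k)%:R *: (W ^+ (n.+3 - k) * conjq W ^+ k.+1)).
  rewrite -big_split /=; apply: eq_bigr => k _; have := ltn_ord k.
  by rewrite ltnS => kn; rewrite subSn// -[(_ - _).+1]add1n natrD scalerDl scale1r.
congr (_ + _).
  rewrite big_ord_recl /= subn0; congr (_ + _); apply: eq_bigr => k _.
  by rewrite /bump /= add1n subSS cW.
rewrite big_ord_recr /= subnn scale0r addr0 mulr_sumr; apply: eq_bigr => k _.
have := ltn_ord k; rewrite ltnS => kn.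
by rewrite -scalerAr mulrA -exprS -subSn//; lia.
Qed.

Lemma sum_d2powV p q n :
  \sum_(e <- quat_basis) d2pow (Qp p q)^-1 (dQpV p q e) (d2QpV p q e) n.+1 =
  - (16 * (qre q - qre p) ^+ 2) *: calC (Negz n) q p
  - 4 *: (- n.+1%:R *: (Qp p q)^-1 ^+ n.+2).
Proof.
rewrite [X in _ = _ - 4 *: X]scaleNr [X in _ = _ - X]scalerN opprK.
set W := (Qp p q)^-1; set d := qre q - qre p.
have cW j k : GRing.comm (conjq W ^+ j) (W ^+ k).
  exact/commrX/commr_sym/commrX/comm_conjq.
have cq j : GRing.comm (W ^+ j) q by exact/commr_sym/commrX/commr_sym/comm_QpV.
(* This is the Laplacian of the inverse itself: [sum_dQp_sandwich] with [x = W], together with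
   [sum_basis_sqr]. It is also the base case, the power being [n.+1]. *)
have d2W : \sum_(e <- quat_basis) d2QpV p q e =
    - (16 * d ^+ 2) *: (W ^+ 2 * conjq W) + 4 *: W ^+ 2.
  transitivity (2 *: (W * (\sum_(e <- quat_basis) dQp p q e * W ^+ 1 * dQp p q e) * W)
     - W * (\sum_(e <- quat_basis) 2 *: (e * e)) * W).
    rewrite [in RHS]mulr_sumr [in RHS]mulr_suml scaler_sumr.
    rewrite [in X in _ = _ - X]mulr_sumr mulr_suml -sumrB.
    by apply: eq_bigr => e _; rewrite /d2QpV -/W expr1 !mulrA.
  rewrite sum_dQp_sandwich; last exact: cq.
  rewrite sum_basis_sqr expr1 -/d; move: (d ^+ 2) => c.
  have cW1 : conjq W * W = W * conjq W by rewrite [RHS]comm_conjq.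
  clearbody W; rewrite mulr_algr -!scalerAr -!scalerAl -mulrA cW1 mulrA -expr2.
  by move: (W ^+ 2) (_ * conjq W) => A B; apply: quatP => /=; ring.
elim: n => [|n IH].
  rewrite big_quat_basis /= !(mulr0, scaler0, addr0, mulr1) -big_quat_basis d2W.
  by rewrite calC_Negz big_ord1 !scale1r conjqV.
under eq_bigr => e _ do rewrite -[d2pow _ _ _ _]/(_ + _ + _).
rewrite !big_split /= -mulr_sumr IH -mulr_suml d2W -scaler_sumr.
have -> : \sum_(e <- quat_basis) dQpV p q e * dpow W (dQpV p q e) n.+1 =
    - (8 * d ^+ 2) *: \sum_(k < n.+1) conjq W ^+ k.+2 * W ^+ (n.+2 - k).
  under eq_bigr do rewrite dpowE mulr_sumr.
  rewrite exchange_big /= scaler_sumr; apply: eq_bigr => k _.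
  (* The signs of the two factors [dQpV] cancel, and their inner inverses raise the enclosed power
     from [k] to [k.+2]. *)
  transitivity (W * (\sum_(e <- quat_basis) dQp p q e * W ^+ k.+2 * dQp p q e) *
      W ^+ (n.+1 - k)).
    rewrite mulr_sumr mulr_suml; apply: eq_bigr => e _.
    have kn := ltn_ord k; rewrite /dQpV -/W !(mulrN, mulNr) opprK.
    by rewrite subSS subSn// [W ^+ k.+2]exprS exprSr [W ^+ (n - k).+1]exprS !mulrA.
  rewrite sum_dQp_sandwich// -scalerAr -scalerAl conjqX; congr (_ *: _).
  have := cW k.+2 1; rewrite expr1 => <-; rewrite -mulrA -exprS -subSn//.
  exact: ltnW (ltn_ord k).
have cW1 := cW 1 n.+1; rewrite expr1 in cW1.
rewrite calC_NegzS -/W.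
move: (\sum_(k < _) _) (calC _ _ _) (d ^+ 2) => A B c.
clear IH d2W cq cW; clearbody W.
rewrite mulrDl -!scalerAl -mulrA cW1 [_ * (_ * conjq _)]mulrA -!exprD !addSn add0n.
rewrite mulrDr -!scalerAr -exprS -[n.+2]add1n natrD.
move: (W ^+ _.+1) => Y; move: (Y * _) (W * B) => X C.
by apply: quatP => /=; ring.
Qed.

Lemma norm_le_sum_const n (F : 'I_n -> H) (a : R) :
  (forall k, `|F k| <= a) -> `|\sum_(k < n) F k| <= n%:R * a.
Proof.
move=> Fa; apply: le_trans (ler_norm_sum _ _ _) _.
apply: le_trans (ler_sum _ (fun k _ => Fa k)) _.
by rewrite sumr_const card_ord mulr_natl.
Qed.

Lemma norm_calL_Posz n q p : `|calL (Posz n) q p| <= n%:R * `|Qp p q| ^+ n.-1.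
Proof.
rewrite calL_Posz; apply: norm_le_sum_const => k; have kn := ltn_ord k.
rewrite normqM !normqX normq_conj -exprD.
by have -> : (n - k.+1 + k = n.-1)%N by lia.
Qed.

Lemma norm_calL_Negz n q p :
  `|calL (Negz n) q p| <= n.+1%:R * `|(Qp p q)^-1| ^+ n.+2.
Proof.
rewrite calL_Negz normrN; apply: norm_le_sum_const => k; have kn := ltn_ord k.
rewrite -conjqV normqM !normqX normq_conj -exprD.
by have -> : (k.+1 + (n.+1 - k) = n.+2)%N by lia.
Qed.

Lemma norm_calC_Posz n q p :
  `|calC (Posz n) q p| <= n%:R ^+ 2 * `|Qp p q| ^+ n.-2.
Proof.
rewrite calC_Posz; apply: le_trans (_ : n.-1%:R * (n%:R * `|Qp p q| ^+ n.-2) <= _).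
  apply: norm_le_sum_const => k; have kn := ltn_ord k.
  rewrite normrZ normqM !normqX normq_conj -exprD normr_nat.
  have -> : (n - k.+2 + k = n.-2)%N by lia.
  by rewrite ler_wpM2r ?exprn_ge0// ler_nat; lia.
rewrite mulrA ler_wpM2r ?exprn_ge0// expr2 ler_wpM2r// ler_nat; lia.
Qed.

Lemma norm_calC_Negz n q p :
  `|calC (Negz n) q p| <= n.+1%:R ^+ 2 * `|(Qp p q)^-1| ^+ n.+3.
Proof.
rewrite calC_Negz expr2 -mulrA; apply: norm_le_sum_const => k; have kn := ltn_ord k.
rewrite -conjqV normrZ normqM !normqX normq_conj -exprD normr_nat.
have -> : (n.+2 - k + k.+1 = n.+3)%N by lia.
by rewrite ler_wpM2r ?exprn_ge0// ler_nat; lia.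
Qed.

End CassiniKernels.

(** * Series and derivatives of quaternionic functions *)

Section QuaternionSeries.
Context {R : realType}.
Local Notation H := (quat R).

Lemma norm_qre_le (x : H) : `|qre x| <= (`|x| : R).
Proof.
rewrite (quat_normE x) /Defs.normq -sqrtr_sqr ler_sqrt ?sqnormq_ge0//.
rewrite /sqnormq -!addrA lerDl !addr_ge0 ?sqr_ge0//.
Qed.
Lemma norm_qi_le (x : H) : `|qi x| <= (`|x| : R).
Proof.
rewrite (quat_normE x) /Defs.normq -sqrtr_sqr ler_sqrt ?sqnormq_ge0//.
rewrite /sqnormq [qre x ^+ 2 + _]addrC -!addrA lerDl !addr_ge0 ?sqr_ge0//.
Qed.
Lemma norm_qj_le (x : H) : `|qj x| <= (`|x| : R).
Proof.
rewrite (quat_normE x) /Defs.normq -sqrtr_sqr ler_sqrt ?sqnormq_ge0//.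
rewrite /sqnormq -addrA addrCA lerDl !addr_ge0 ?sqr_ge0//.
Qed.
Lemma norm_qk_le (x : H) : `|qk x| <= (`|x| : R).
Proof.
rewrite (quat_normE x) /Defs.normq -sqrtr_sqr ler_sqrt ?sqnormq_ge0//.
rewrite /sqnormq lerDr !addr_ge0 ?sqr_ge0//.
Qed.

(** Each real coordinate is dominated by the norm, so completeness of [R] applied four times
    suffices. *)
Lemma norm_cvg_series (u : nat -> H) :
  cvgn (series (fun n => `|u n| : R)) -> cvgn (series u).
Proof.
move=> cu.
have comp (c : H -> R) : (forall x, `|c x| <= `|x|) -> cvgn (series (c \o u)).
  move=> cle; apply: normed_cvg; apply: series_le_cvg cu => n /=;
    rewrite ?normr_ge0//; exact: cle.
have -> : series u = (fun N =>
    series (@qre R \o u) N *: (1 : H) + series (@qi R \o u) N *: (e1 : H)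
    + series (@qj R \o u) N *: (e2 : H) + series (@qk R \o u) N *: (e3 : H)).
  apply/funext => N; rewrite !seriesEnat /=.
  elim: N => [|N IH]; first by rewrite !big_geq// !scale0r !addr0.
  by rewrite !big_nat_recr//= IH; apply: quatP => /=; ring.
do 3?[apply: is_cvgD]; apply: is_cvgZr_tmp; apply: comp.
- exact: norm_qre_le.
- exact: norm_qi_le.
- exact: norm_qj_le.
- exact: norm_qk_le.
Qed.

Lemma cvg_series_dominated (u : nat -> H) (M : R^nat) :
  (forall n, `|u n| <= M n) -> cvgn (series M) -> cvgn (series u).
Proof.
move=> uM cM; apply: norm_cvg_series; apply: series_le_cvg cM => n //.
by apply: le_trans (uM n).
Qed.

Lemma norm_series_tail_le (u : nat -> H) (M : R^nat) N :
  (forall n, `|u n| <= M n) -> cvgn (series M) ->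
  `|limn (series u) - series u N| <= limn (series M) - series M N.
Proof.
move=> uM cM; have cu := cvg_series_dominated uM cM.
have c1 : `|series u n - series u N| @[n --> \oo] -->
    `|limn (series u) - series u N|.
  by apply: cvg_norm; apply: cvgB => //; exact: cvg_cst.
have c2 : (series M n - series M N : R) @[n --> \oo] -->
    limn (series M) - series M N.
  by apply: cvgB => //; exact: cvg_cst.
rewrite -(cvg_lim _ c1)// -(cvg_lim _ c2)//; apply: ler_lim.
- by apply/cvg_ex; eexists; exact: c1.
- by apply/cvg_ex; eexists; exact: c2.
near=> n; have Nn : (N <= n)%N by near: n; exact: nbhs_infty_ge.
rewrite !sub_series Nn; apply: le_trans (ler_norm_sum _ _ _) _.
exact: ler_sum.
Unshelve. all: by end_near.
Qed.

End QuaternionSeries.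

Section QuaternionDerivative.
Context {R : realType}.
Local Notation H := (quat R).
Implicit Types (f g : H -> H) (x e : H).

Lemma is_deriveP f x e (l : H) :
  h^-1 *: (f (h *: e + x) - f x) @[h --> (0:R)^'] --> l <-> is_derive x e f l.
Proof.
split=> [fl|[df <-]]; last exact: df.
by split; [apply/cvg_ex; exists l|exact: cvg_lim].
Qed.

Lemma cvg_mulq {T : Type} (F : set_system T) {FF : Filter F} (f g : T -> H)
    (a b : H) :
  f @ F --> a -> g @ F --> b -> f t * g t @[t --> F] --> a * b.
Proof.
move=> fa gb; apply/subr_cvg0; apply: norm_cvg0.
apply: (squeeze_cvgr (f := cst 0)
  (h := fun t => `|f t| * `|g t - b| + `|f t - a| * `|b| : R)).
- near=> t; rewrite normr_ge0 /=.
  have -> : f t * g t - a * b = f t * (g t - b) + (f t - a) * b.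
    by rewrite mulrBr mulrBl addrA subrK.
  by apply: le_trans (ler_normD _ _) _; rewrite !normqM.
- exact: cvg_cst.
- have -> : (0 : R) = `|a| * `|b - b| + `|a - a| * `|b|.
    by rewrite !subrr !normr0 mulr0 mul0r addr0.
  apply: cvgD; apply: cvgM; try exact: cvg_cst.
  + exact: cvg_norm.
  + by apply: cvg_norm; apply: cvgB => //; exact: cvg_cst.
  + by apply: cvg_norm; apply: cvgB => //; exact: cvg_cst.
Unshelve. all: by end_near.
Qed.

(** A directional derivative gives continuity only along its line, which is all that the product and
    inverse rules require. *)
Lemma cvg_along (f : H -> H) x e df : is_derive x e f df ->
  f (h *: e + x) @[h --> (0:R)^'] --> f x.
Proof.
move=> [+ _] => /derivable1P/derivable1_diffP/differentiable_continuous.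
by move=> /continuous_withinNx; rewrite scale0r add0r.
Qed.

Lemma is_derive_mulq f g x e df dg : is_derive x e f df -> is_derive x e g dg ->
  is_derive x e (fun y => f y * g y) (df * g x + f x * dg).
Proof.
move=> fd gd; apply/is_deriveP.
have -> : (fun h : R => h^-1 *: (f (h *: e + x) * g (h *: e + x) - f x * g x)) =
    (fun h => h^-1 *: (f (h *: e + x) - f x) * g (h *: e + x)
              + f x * (h^-1 *: (g (h *: e + x) - g x))).
  by apply/funext => h; rewrite -scalerAl -scalerAr -scalerDr mulrBl mulrBr addrA subrK.
apply: cvgD; apply: cvg_mulq.
- exact/is_deriveP.
- exact: cvg_along gd.
- exact: cvg_cst.
- exact/is_deriveP.
Qed.

Lemma cvg_conjq {T : Type} (F : set_system T) {FF : Filter F} (f : T -> H) (a : H) :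
  f @ F --> a -> conjq (f t) @[t --> F] --> conjq a.
Proof.
move=> /cvgrPdist_le fa; apply/cvgrPdist_le => eps eps0.
apply: filterS (fa eps eps0) => t.
have -> : conjq a - conjq (f t) = conjq (a - f t) by apply: quatP => /=; ring.
by rewrite normq_conj.
Qed.

Lemma invqE (x : H) : x^-1 = (`|x| ^+ 2)^-1 *: conjq x.
Proof. by rewrite normq_sqr. Qed.

Lemma is_derive_invq f x e df : f x != 0 -> is_derive x e f df ->
  is_derive x e (fun y => (f y)^-1) (- ((f x)^-1 * df * (f x)^-1)).
Proof.
move=> fx0 fd; have fc := cvg_along fd.
have nz : \forall h \near (0:R)^', f (h *: e + x) != 0.
  have : `|f (h *: e + x)| @[h --> (0:R)^'] --> (`|f x| : R) by exact: cvg_norm.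
  move=> /cvgr_gt/(_ 0); rewrite normr_gt0 => /(_ fx0).
  by apply: filterS => h; rewrite normr_gt0.
apply/is_deriveP.
have cV : (f (h *: e + x))^-1 @[h --> (0:R)^'] --> (f x)^-1.
  under eq_fun do rewrite invqE.
  rewrite invqE; apply: cvgZ.
    apply: cvgV; first by rewrite sqrf_eq0 normr_eq0.
    by rewrite expr2; apply: cvgM; exact: cvg_norm.
  exact: cvg_conjq.
(* Since [A^-1 - B^-1 = - A^-1 * (A - B) * B^-1] for units, this is the difference quotient of the
   inverse as soon as [f (h *: e + x)] is nonzero. *)
have : - ((f (h *: e + x))^-1 * (h^-1 *: (f (h *: e + x) - f x)) * (f x)^-1)
    @[h --> (0:R)^'] --> - ((f x)^-1 * df * (f x)^-1).
  apply: cvgN; apply: cvg_mulq; last exact: cvg_cst.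
  by apply: cvg_mulq => //; exact/is_deriveP.
apply: cvg_trans; apply: near_eq_cvg; near=> h.
have fh0 : f (h *: e + x) != 0 by near: h.
have : f x * (f x)^-1 = 1 by rewrite mulrV.
have : (f (h *: e + x))^-1 * f (h *: e + x) = 1 by rewrite mulVr.
move: (f (h *: e + x))^-1 (f x)^-1 => A B Af fB.
rewrite -scalerAr -scalerAl -scalerN; congr (_ *: _).
by rewrite mulrBr mulrBl Af mul1r -mulrA fB mulr1 opprB.
Unshelve. all: by end_near.
Qed.

(** Bound and Lipschitz constant travel together because the Lipschitz constant of a product
    involves both. Estimates for derivatives then follow by algebra, without a mean value
    theorem. *)
Definition lip_on (K : set H) (f : H -> H) (a b : R) : Prop :=
  (forall y, K y -> `|f y| <= a) /\
  (forall y z, K y -> K z -> `|f y - f z| <= b * `|y - z|).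

(** A three-epsilon argument. As [e] is a unit vector, the increments of [u n] are at most
    [|h| * M n], so the tail of the difference quotients is bounded by that of [M] uniformly in [h].
    The tail of [v] is bounded by that of [M'], and the finite sum up to [N] is differentiable. *)
Lemma is_derive_series (K : set H) x e (u v : nat -> H -> H) (m M M' : R^nat) :
  open K -> K x -> `|e| = 1 :> R ->
  (forall n, lip_on K (u n) (m n) (M n)) ->
  (forall n, `|v n x| <= M' n) ->
  (forall n, is_derive x e (u n) (v n x)) ->
  cvgn (series m) -> cvgn (series M) -> cvgn (series M') ->
  is_derive x e (fun y => limn (series (u ^~ y))) (limn (series (v ^~ x))).
Proof.
move=> oK Kx e1 ulip vM uv cm cM cM'; apply/is_deriveP/cvgrPdist_le => eps eps0.
have cu y : K y -> cvgn (series (u ^~ y)).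
  by move=> Ky; apply: cvg_series_dominated cm => n; case: (ulip n) => + _; apply.
have [N [tM tM']] : exists N, limn (series M) - series M N <= eps / 3 /\
    limn (series M') - series M' N <= eps / 3.
  have e3 : 0 < eps / 3 by rewrite divr_gt0.
  have /cvgrPdist_le/(_ _ e3) h1 := cM; have /cvgrPdist_le/(_ _ e3) h2 := cM'.
  have [N _ hN] : \forall N \near \oo,
      `|limn (series M) - series M N| <= eps / 3 /\
      `|limn (series M') - series M' N| <= eps / 3 by apply: filterI.
  by exists N; have [a b] := hN N (leqnn _); split;
     [exact: le_trans (ler_norm _) a|exact: le_trans (ler_norm _) b].
have dS : is_derive x e (fun y => series (u ^~ y) N) (series (v ^~ x) N).
  rewrite /series /=; elim: N {tM tM'} => [|N IH].
    by under eq_fun do rewrite big_geq//; rewrite big_geq//; exact: is_derive_cst.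
  under eq_fun do rewrite big_nat_recr//=.
  by rewrite big_nat_recr//=; exact: is_deriveD.
move/is_deriveP/cvgrPdist_le/(_ (eps / 3)) : dS => /(_ _)/[!divr_gt0]// /(_ isT) dS.
have cx : (h *: e + x) @[h --> (0:R)^'] --> x by exact: (cvg_along (is_derive_id _ _)).
have nK : \forall h \near (0:R)^', K (h *: e + x) by apply: cx; exact: open_nbhs_nbhs.
near=> h.
have Ky : K (h *: e + x) by near: h.
have h0 : h != 0 by near: h; exact: nbhs_dnbhs_neq.
have hS : `|series (v ^~ x) N
    - h^-1 *: (series (u ^~ (h *: e + x)) N - series (u ^~ x) N)| <= eps / 3.
  by near: h.
move: Ky hS; set y := h *: e + x => Ky hS.
pose w n := u n y - u n x.
have wM n : `|w n| <= (`|h| *: M) n.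
  have [_ /(_ y x Ky Kx)] := ulip n.
  by rewrite /y addrK normrZ e1 mulr1 mulrC.
have chM : cvgn (series (`|h| *: M)) by exact: is_cvg_seriesZ.
have sw : series w = series (u ^~ y) - series (u ^~ x).
  by rewrite -[in RHS]seriesN -seriesD.
have tw := norm_series_tail_le N wM chM.
rewrite lim_seriesZ// seriesZ in tw.
rewrite sw limB in tw; [|exact: cu..].
have tv := norm_series_tail_le N vM cM'.
have {}tw : `|h^-1 *: (limn (series (u ^~ y)) - limn (series (u ^~ x))
    - (series (u ^~ y) - series (u ^~ x)) N)| <= eps / 3.
  rewrite normrZ normfV ler_pdivrMl ?normr_gt0//.
  apply: le_trans tw _.
  apply: le_trans (_ : `|h| * (limn (series M) - series M N) <= _).
    by rewrite mulrBr.
  by rewrite ler_wpM2l.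
have -> : limn (series (v ^~ x))
   - h^-1 *: (limn (series (u ^~ y)) - limn (series (u ^~ x))) =
   (series (v ^~ x) N - h^-1 *: (series (u ^~ y) N - series (u ^~ x) N))
   + (limn (series (v ^~ x)) - series (v ^~ x) N)
   - h^-1 *: (limn (series (u ^~ y)) - limn (series (u ^~ x))
    - (series (u ^~ y) - series (u ^~ x)) N).
  by move: (limn _) (limn _) (limn _) => A B C; apply: quatP => /=; ring.
apply: le_trans (ler_normB _ _) _.
apply: le_trans (lerD (ler_normD _ _) (lexx _)) _.
have {}tv := le_trans tv tM'.
lra.
Unshelve. all: by end_near.
Qed.
End QuaternionDerivative.

(** * Bounds on powers and termwise differentiation *)

Section BoundedLipschitz.
Context {R : realType}.
Local Notation H := (quat R).
Implicit Types (K : set H) (f g : H -> H) (a b c r : R).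

Lemma lip_on_le K f a b a' b' : a <= a' -> b <= b' ->
  lip_on K f a b -> lip_on K f a' b'.
Proof.
move=> aa bb [fa fb]; split=> [y /fa /le_trans|y z Ky Kz]; first exact.
by apply: le_trans (fb y z Ky Kz) _; rewrite ler_wpM2r.
Qed.

Lemma lip_on_cst K (x : H) : lip_on K (cst x) `|x| 0.
Proof. by split=> //= y z _ _; rewrite subrr normr0 mul0r. Qed.

Lemma lip_onD K f g a b a' b' : lip_on K f a b -> lip_on K g a' b' ->
  lip_on K (fun y => f y + g y) (a + a') (b + b').
Proof.
move=> [fa fb] [ga gb]; split=> [y Ky|y z Ky Kz].
  by apply: le_trans (ler_normD _ _) _; rewrite lerD ?fa ?ga.
rewrite opprD addrACA mulrDl; apply: le_trans (ler_normD _ _) _.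
by rewrite lerD ?fb ?gb.
Qed.

Lemma lip_onN K f a b : lip_on K f a b -> lip_on K (fun y => - f y) a b.
Proof.
move=> [fa fb]; split=> [y Ky|y z Ky Kz]; first by rewrite normrN fa.
by rewrite -opprD normrN fb.
Qed.

Lemma lip_onM K f g a b a' b' : lip_on K f a b -> lip_on K g a' b' ->
  lip_on K (fun y => f y * g y) (a * a') (a * b' + b * a').
Proof.
move=> [fa fb] [ga gb]; split=> [y Ky|y z Ky Kz].
  by rewrite normqM ler_pM ?fa ?ga.
have -> : f y * g y - f z * g z = f y * (g y - g z) + (f y - f z) * g z.
  by rewrite mulrBr mulrBl addrA subrK.
apply: le_trans (ler_normD _ _) _; rewrite !normqM mulrDl lerD//.
  by rewrite -mulrA ler_pM ?fa ?gb.
by rewrite mulrAC ler_pM ?fb ?ga.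
Qed.

Lemma lip_onV K f a b s : (forall y, K y -> f y != 0 /\ `|(f y)^-1| <= s) ->
  lip_on K f a b -> lip_on K (fun y => (f y)^-1) s (s * b * s).
Proof.
move=> fs [fa fb]; split=> [y /fs[]//|y z Ky Kz].
have [fy0 fys] := fs y Ky; have [fz0 fzs] := fs z Kz.
have -> : (f y)^-1 - (f z)^-1 = (f y)^-1 * - (f y - f z) * (f z)^-1.
  rewrite mulrN mulrBr mulVr// mulNr mulrBl mul1r -mulrA mulrV// mulr1.
  by rewrite opprB.
rewrite !normqM normrN [s * b * s * _]mulrAC ler_pM ?mulr_ge0//.
by rewrite -mulrA ler_pM ?fb.
Qed.

(** The constant is [n c r^(n-1)], written with [c / r] to avoid a predecessor in the exponent. *)
Lemma lip_on_pow K f r c n : 0 < r -> lip_on K f r c ->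
  lip_on K (fun y => f y ^+ n) (r ^+ n) (n%:R * (c / r) * r ^+ n).
Proof.
move=> r0 fK; elim: n => [|n IH].
  rewrite mul0r mul0r; apply: (lip_on_le _ _ (lip_on_cst K 1)) => //.
  by rewrite normq1.
have -> : (fun y => f y ^+ n.+1) = (fun y => f y * f y ^+ n).
  by apply/funext => y; rewrite exprS.
apply: (lip_on_le _ _ (lip_onM fK IH)); rewrite ?exprS//.
rewrite -natr1 le_eqVlt; apply/orP; left; apply/eqP.
by field; rewrite gt_eqF.
Qed.

(** In terms of the ratio [c / r] the constant keeps the geometric factor [r ^+ n] and only gains
    quadratic growth in [n], which the gap between two radii can absorb. *)
Lemma lip_on_dpow K (f f1 : H -> H) r c n : 0 < r -> 0 <= c ->
  lip_on K f r c -> lip_on K f1 c c ->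
  lip_on K (fun y => dpow (f y) (f1 y) n) (n%:R * (c / r) * r ^+ n)
    (n%:R ^+ 2 * (c / r + (c / r) ^+ 2) * r ^+ n).
Proof.
move=> r0 c0 fK f1K; elim: n => [|n IH].
  rewrite expr2 !mul0r; apply: (lip_on_le _ _ (lip_on_cst K 0)) => //.
  by rewrite normr0.
apply: (lip_on_le _ _ (lip_onD
  (lip_onM f1K (lip_on_pow n r0 fK))
  (lip_onM fK IH))).
  rewrite -natr1 exprS le_eqVlt; apply/orP; left; apply/eqP.
  by field; rewrite gt_eqF.
have k0 : 0 <= c / r by rewrite divr_ge0// ltW.
have ck : c = c / r * r by rewrite divfK// gt_eqF.
(* With [k] for [c / r] everything is a multiple of [r * r ^+ n], and the slack of the induction
   step is [2 n k + k^2]. *)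
rewrite -natr1 [r ^+ n.+1]exprS; move: (c / r) k0 ck => k k0 ->.
rewrite -subr_ge0.
rewrite [X in 0 <= X](_ : _ = (n%:R * k * 2 + k ^+ 2) * (r * r ^+ n)); last by ring.
by rewrite mulr_ge0 ?mulr_ge0 ?addr_ge0 ?mulr_ge0 ?exprn_ge0// ltW.
Qed.

Lemma norm_d2pow_le K (f f1 f2 : H -> H) r c n y : 0 < r -> 0 <= c ->
  lip_on K f r c -> lip_on K f1 c c -> `|f2 y| <= c -> K y ->
  `|d2pow (f y) (f1 y) (f2 y) n| <=
    n%:R ^+ 2 * (c / r + (c / r) ^+ 2) * r ^+ n.
Proof.
move=> r0 c0 fK f1K f2c Ky; elim: n => [|n IH].
  by rewrite /= normr0 expr2 !mul0r.
have [/(_ y Ky) hp _] := lip_on_pow n r0 fK.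
have [/(_ y Ky) hd _] := lip_on_dpow n r0 c0 fK f1K.
have [/(_ y Ky) f1c _] := f1K; have [/(_ y Ky) fc _] := fK.
have h1 : `|f2 y * f y ^+ n| <= c * r ^+ n by rewrite normqM ler_pM.
have h2 : `|2 *: (f1 y * dpow (f y) (f1 y) n)| <= 2 * (c * (n%:R * (c / r) * r ^+ n)).
  by rewrite normrZ normr_nat ler_wpM2l// normqM ler_pM.
have h3 : `|f y * d2pow (f y) (f1 y) (f2 y) n| <=
   r * (n%:R ^+ 2 * (c / r + (c / r) ^+ 2) * r ^+ n) by rewrite normqM ler_pM.
rewrite /=; apply: le_trans (ler_normD _ _) _.
apply: le_trans (lerD (ler_normD _ _) h3) _.
apply: le_trans (lerD (lerD h1 h2) (lexx _)) _.
have k0 : 0 <= c / r by rewrite divr_ge0// ltW.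
have ck : c = c / r * r by rewrite divfK// gt_eqF.
rewrite -natr1 [r ^+ n.+1]exprS; move: (c / r) k0 ck => k k0 ->.
rewrite -subr_ge0.
rewrite [X in 0 <= X](_ : _ = (n%:R * k * 2 + k ^+ 2) * (r * r ^+ n)); last by ring.
by rewrite mulr_ge0 ?mulr_ge0 ?addr_ge0 ?mulr_ge0 ?exprn_ge0// ltW.
Qed.

End BoundedLipschitz.

Section PowerSeries.
Context {R : realType}.
Local Notation H := (quat R).
Implicit Types (K : set H) (b : H -> H) (p q x y e : H) (a c : nat -> H).

Lemma is_derive_pow b (b1 : H -> H) y e n : is_derive y e b (b1 y) ->
  is_derive y e (fun z => b z ^+ n) (dpow (b y) (b1 y) n).
Proof.
move=> db; elim: n => [|n IH]; first exact: is_derive_cst.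
under eq_fun do rewrite exprS; exact: is_derive_mulq.
Qed.

Lemma is_derive_dpow b (b1 b2 : H -> H) y e n :
  is_derive y e b (b1 y) -> is_derive y e b1 (b2 y) ->
  is_derive y e (fun z => dpow (b z) (b1 z) n) (d2pow (b y) (b1 y) (b2 y) n).
Proof.
move=> db db1; elim: n => [|n IH]; first exact: is_derive_cst.
have -> : d2pow (b y) (b1 y) (b2 y) n.+1 =
    (b2 y * b y ^+ n + b1 y * dpow (b y) (b1 y) n)
    + (b1 y * dpow (b y) (b1 y) n + b y * d2pow (b y) (b1 y) (b2 y) n).
  by rewrite /= scaler_nat mulr2n !addrA.
apply: is_deriveD; apply: is_derive_mulq => //; exact: is_derive_pow.
Qed.

(* With [b] the polynomial [Qp p] and [s = 0] these are the Laurent terms of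
   index [n >= 0]; with [b] its inverse and [s = 1], those of index [-(n + 1)]. *)
Definition pterm b p a c (s n : nat) y : H := b y ^+ (s + n) * (a n + (y - p) * c n).
Definition dterm b (b1 : H -> H) p a c (s : nat) e n y : H :=
  dpow (b y) (b1 y) (s + n) * (a n + (y - p) * c n) + b y ^+ (s + n) * (e * c n).
Definition d2term b (b1 b2 : H -> H) p a c (s : nat) e n y : H :=
  d2pow (b y) (b1 y) (b2 y) (s + n) * (a n + (y - p) * c n)
  + 2 *: (dpow (b y) (b1 y) (s + n) * (e * c n)).

Lemma is_derive_affine p (u v : H) y e :
  is_derive y e (fun z => u + (z - p) * v) (e * v).
Proof.
rewrite -[e * v]add0r.
apply: (is_deriveD (f := cst u) (g := fun z => (z - p) * v)).
have -> : e * v = e * v + (y - p) * 0 by rewrite mulr0 addr0.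
apply: (is_derive_mulq (f := fun z => z - p) (g := cst v)).
rewrite -[X in is_derive _ _ _ X]subr0; exact: (is_deriveB (f := id) (g := cst p)).
Qed.

Lemma is_derive_pterm b (b1 : H -> H) p a c s e n y : is_derive y e b (b1 y) ->
  is_derive y e (pterm b p a c s n) (dterm b b1 p a c s e n y).
Proof.
move=> db; apply: is_derive_mulq; first exact: is_derive_pow.
exact: is_derive_affine.
Qed.

Lemma is_derive_dterm b (b1 b2 : H -> H) p a c s e n y :
  is_derive y e b (b1 y) -> is_derive y e b1 (b2 y) ->
  is_derive y e (dterm b b1 p a c s e n) (d2term b b1 b2 p a c s e n y).
Proof.
move=> db db1.
have -> : d2term b b1 b2 p a c s e n y =
   (d2pow (b y) (b1 y) (b2 y) (s + n) * (a n + (y - p) * c n)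
    + dpow (b y) (b1 y) (s + n) * (e * c n))
   + (dpow (b y) (b1 y) (s + n) * (e * c n) + b y ^+ (s + n) * 0).
  by rewrite mulr0 addr0 /d2term scaler_nat mulr2n !addrA.
apply: is_deriveD; apply: is_derive_mulq.
- exact: is_derive_dpow.
- exact: is_derive_affine.
- exact: is_derive_pow.
Qed.

(** The quadratic weight covers two differentiations; the successor keeps it at least 1 at exponent
    0, where the undifferentiated term must fit as well. *)
Definition majorant (r : R) a c s n : R :=
  (s + n).+1%:R ^+ 2 * r ^+ (s + n) * (`|a n| + `|c n|).

(** Here [t] is the exponent and [k] the ratio [l / r]. The left side covers the coefficients of a
    term and of its first two derivatives; the difference of the two sides is a polynomial with
    nonnegative coefficients. *)
Lemma coef_bound (t k : R) : 0 <= t -> 0 <= k ->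
  1 + 2 * t * k + t ^+ 2 * (k + k ^+ 2) <= 4 * (1 + k + k ^+ 2) * (t + 1) ^+ 2.
Proof.
move=> t0 k0; rewrite -subr_ge0.
rewrite [X in 0 <= X](_ : _ = 3 + 4 * t ^+ 2 + 8 * t
  + (4 * k + 6 * t * k + 3 * t ^+ 2 * k)
  + (4 * k ^+ 2 + 8 * t * k ^+ 2 + 3 * t ^+ 2 * k ^+ 2)); last by ring.
by rewrite !addr_ge0 ?mulr_ge0 ?sqr_ge0.
Qed.

Section Bounds.
Variables (K : set H) (b b1 b2 : H -> H) (p e : H) (a c : nat -> H) (s : nat).
Variables (r l rho : R).
Hypotheses (e1 : `|e| = 1 :> R) (r0 : 0 < r) (l0 : 0 <= l) (rho0 : 0 <= rho).
Hypotheses (bK : lip_on K b r l) (b1K : lip_on K b1 l l).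
Hypotheses (b2K : forall y, K y -> `|b2 y| <= l).
Hypotheses (pK : forall y, K y -> `|y - p| <= rho).

Let k := l / r.
(** The resulting [M] serves at once for the values and Lipschitz constants of the terms and of
    their first derivatives, and for the second derivatives. The factor [rho + 1] comes from the
    affine factor, controlled by [B]. *)
Let L := 4 * (1 + k + k ^+ 2) * (rho + 1).
Let M n := L * majorant r a c s n.
Let B n := (rho + 1) * (`|a n| + `|c n|).

Let k0 : 0 <= k. Proof. by rewrite divr_ge0// ltW. Qed.
Let coef_le n (x : R) :
  x <= 1 + 2 * (s + n)%:R * k + (s + n)%:R ^+ 2 * (k + k ^+ 2) ->
  x * (r ^+ (s + n) * B n) <= M n.
Proof.
move=> xle.
have -> : M n = 4 * (1 + k + k ^+ 2) * ((s + n)%:R + 1) ^+ 2 * (r ^+ (s + n) * B n).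
  by rewrite /M /majorant /L /B natr1; ring.
rewrite ler_wpM2r ?mulr_ge0 ?exprn_ge0 ?(ltW r0) ?addr_ge0//.
apply: le_trans xle _; exact: coef_bound.
Qed.

Let tk n : 0 <= (s + n)%:R * k. Proof. by rewrite mulr_ge0. Qed.
Let tkk n : 0 <= (s + n)%:R ^+ 2 * (k + k ^+ 2).
Proof. by rewrite mulr_ge0 ?sqr_ge0 ?addr_ge0 ?sqr_ge0. Qed.

Let lip_affine n : lip_on K (fun y => a n + (y - p) * c n) (B n) (B n).
Proof.
have idK : lip_on K (fun y => y - p) rho 1.
  by split=> // y z _ _; rewrite mul1r opprB addrA subrK.
apply: (lip_on_le _ _ (lip_onD (lip_on_cst K (a n))
    (lip_onM idK (lip_on_cst K (c n))))); rewrite /B.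
  have := mulr_ge0 rho0 (normr_ge0 (a n)); have := normr_ge0 (c n); lra.
have := mulr_ge0 rho0 (normr_ge0 (a n)); have := mulr_ge0 rho0 (normr_ge0 (c n)).
have := normr_ge0 (a n); lra.
Qed.

Let c_le n : `|e * c n| <= B n.
Proof.
rewrite normqM e1 mul1r /B.
have := mulr_ge0 rho0 (normr_ge0 (a n)); have := mulr_ge0 rho0 (normr_ge0 (c n)).
have := normr_ge0 (a n); lra.
Qed.

Let lip_ec n : lip_on K (cst (e * c n)) (B n) 0.
Proof. exact: (lip_on_le (c_le n) (lexx 0) (lip_on_cst K _)). Qed.

Let lip_pterm n : lip_on K (pterm b p a c s n) (M n) (M n).
Proof.
apply: (lip_on_le _ _ (lip_onM (lip_on_pow (s + n) r0 bK) (lip_affine n))).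
- rewrite -[X in X <= _]mul1r; apply: coef_le; have := tk n; have := tkk n; lra.
- rewrite [X in X <= _](_ : _ = (1 + (s + n)%:R * k) * (r ^+ (s + n) * B n)).
    by apply: coef_le; have := tk n; have := tkk n; lra.
  by rewrite /k; ring.
Qed.

Let lip_dterm n : lip_on K (dterm b b1 p a c s e n) (M n) (M n).
Proof.
apply: (lip_on_le _ _ (lip_onD
  (lip_onM (lip_on_dpow (s + n) r0 l0 bK b1K) (lip_affine n))
  (lip_onM (lip_on_pow (s + n) r0 bK) (lip_ec n)))).
- rewrite [X in X <= _](_ : _ = (1 + (s + n)%:R * k) * (r ^+ (s + n) * B n)).
    by apply: coef_le; have := tk n; have := tkk n; lra.
  by rewrite /k; ring.
- rewrite [X in X <= _](_ : _ = (2 * (s + n)%:R * k + (s + n)%:R ^+ 2 * (k + k ^+ 2))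
      * (r ^+ (s + n) * B n)).
    by apply: coef_le; have := tk n; have := tkk n; lra.
  by rewrite /k; ring.
Qed.

Let norm_d2term n y : K y -> `|d2term b b1 b2 p a c s e n y| <= M n.
Proof.
move=> Ky; have [/(_ y Ky) ha _] := lip_affine n.
have [/(_ y Ky) hd _] := lip_on_dpow (s + n) r0 l0 bK b1K.
have h2 := norm_d2pow_le (s + n) r0 l0 bK b1K (b2K Ky) Ky.
apply: le_trans (ler_normD _ _) _; rewrite normrZ !normqM normr_nat.
rewrite -[`|e| * _]normqM.
apply: le_trans (lerD (ler_pM _ _ h2 ha)
  (ler_wpM2l _ (ler_pM _ _ hd (c_le n)))) _ => //.
rewrite [X in X <= _](_ : _ = (2 * (s + n)%:R * k + (s + n)%:R ^+ 2 * (k + k ^+ 2))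
      * (r ^+ (s + n) * B n)).
  by apply: coef_le; have := tk n; have := tkk n; lra.
by rewrite /k; ring.
Qed.

Hypothesis cvgM : cvgn (series (majorant r a c s)).
Hypothesis openK : open K.
Hypothesis db : forall y, K y -> is_derive y e b (b1 y).
Hypothesis db1 : forall y, K y -> is_derive y e b1 (b2 y).

Lemma power_series_derive2 y : K y ->
  [/\ cvgn (series ((d2term b b1 b2 p a c s e)^~ y)),
      is_derive y e (fun z => limn (series ((pterm b p a c s)^~ z)))
        (limn (series ((dterm b b1 p a c s e)^~ y))) &
      is_derive y e (fun z => limn (series ((dterm b b1 p a c s e)^~ z)))
        (limn (series ((d2term b b1 b2 p a c s e)^~ y)))].
Proof.
move=> Ky; have cM : cvgn (series M).
  have -> : M = L *: majorant r a c s by [].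
  exact: is_cvg_seriesZ.
split.
- exact: (cvg_series_dominated (fun n => norm_d2term n Ky) cM).
- apply: (is_derive_series openK Ky e1 lip_pterm _ _ cM cM cM) => n.
  + by have [/(_ y Ky)] := lip_dterm n.
  + exact: is_derive_pterm (db Ky).
- apply: (is_derive_series openK Ky e1 lip_dterm _ _ cM cM cM) => n.
  + exact: norm_d2term.
  + exact: is_derive_dterm (db Ky) (db1 Ky).
Qed.

End Bounds.
End PowerSeries.

(** * Local bounds and summability on the Cassini shell *)

Section CassiniBounds.
Context {R : realType}.
Local Notation H := (quat R).
Implicit Types (K : set H) (f g : H -> H) (p q x y e : H) (r s l : R).

(** Used where the value of the constant is irrelevant: sums and products then need no
    bookkeeping. *)
Definition bounded_lipschitz K f := exists2 l, 0 <= l & lip_on K f l l.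

Lemma lip_on_bounded_lipschitz K f r l : lip_on K f r l -> bounded_lipschitz K f.
Proof.
move=> fK; exists (`|r| + `|l|); first exact: addr_ge0.
apply: lip_on_le fK.
  by apply: le_trans (ler_norm _) _; rewrite lerDl.
by apply: le_trans (ler_norm _) _; rewrite lerDr.
Qed.

Lemma bounded_lipschitz_cst K (x : H) : bounded_lipschitz K (cst x).
Proof. exact: lip_on_bounded_lipschitz (lip_on_cst K x). Qed.

Lemma bounded_lipschitzD K f g : bounded_lipschitz K f -> bounded_lipschitz K g ->
  bounded_lipschitz K (fun y => f y + g y).
Proof.
by move=> [l _ fK] [m _ gK]; exact: lip_on_bounded_lipschitz (lip_onD fK gK).
Qed.

Lemma bounded_lipschitzN K f : bounded_lipschitz K f ->
  bounded_lipschitz K (fun y => - f y).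
Proof. by move=> [l _ fK]; exact: lip_on_bounded_lipschitz (lip_onN fK). Qed.

Lemma bounded_lipschitzM K f g : bounded_lipschitz K f -> bounded_lipschitz K g ->
  bounded_lipschitz K (fun y => f y * g y).
Proof.
by move=> [l _ fK] [m _ gK]; exact: lip_on_bounded_lipschitz (lip_onM fK gK).
Qed.

Lemma bounded_lipschitz_Qp K p : bounded_lipschitz K id ->
  bounded_lipschitz K (Qp p).
Proof.
move=> idK.
have -> : Qp p = (fun y => y * y + - ((2 * qre p)%:A * y) + (`|p| ^+ 2)%:A).
  by apply/funext => y; rewrite /Qp expr2 mulr_algl.
apply: bounded_lipschitzD; last exact: bounded_lipschitz_cst.
apply: bounded_lipschitzD; first exact: bounded_lipschitzM.
apply: bounded_lipschitzN; apply: bounded_lipschitzM => //.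
exact: bounded_lipschitz_cst.
Qed.

Lemma bounded_lipschitz_dQp K p e : bounded_lipschitz K id ->
  bounded_lipschitz K (dQp p ^~ e).
Proof.
move=> idK; have cK x := bounded_lipschitz_cst K x.
apply: bounded_lipschitzD; last exact: cK.
by apply: bounded_lipschitzD; apply: bounded_lipschitzM => //; exact: cK.
Qed.

Lemma bounded_lipschitz_ball q r : bounded_lipschitz (ball q r) id.
Proof.
apply: (@lip_on_bounded_lipschitz _ _ (`|q| + r) 1); split=> [y|y z _ _]; last first.
  by rewrite mul1r.
rewrite -ball_normE /= => /ltW qy; rewrite -[y](subrKC q).
by apply: le_trans (ler_normD _ _) _; rewrite lerD2l distrC.
Qed.

Lemma Qp_near p q r s : r < `|Qp p q| < s -> exists2 d, 0 < d &
  forall y, ball q d y -> r <= `|Qp p y| <= s.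
Proof.
move=> /andP[rq qs].
have [l l0 [_ lK]] := bounded_lipschitz_Qp p (bounded_lipschitz_ball q 1).
pose t := Num.min (`|Qp p q| - r) (s - `|Qp p q|).
have t0 : 0 < t by rewrite lt_min !subr_gt0 rq.
have l1 : 0 < l + 1 by rewrite ltr_wpDl.
(* The minimum with 1 stays in the ball where [l] is valid, and [l + 1] avoids dividing by a
   possibly zero [l]. *)
exists (Num.min 1 (t / (l + 1))); first by rewrite lt_min ltr01 divr_gt0.
move=> y; rewrite -ball_normE /= lt_min => /andP[qy1 qyt].
have := lK q y (ballxx _ _) _; rewrite -ball_normE /= => /(_ ltr01 qy1) h.
have {}h : `|Qp p q - Qp p y| <= t.
  apply: le_trans h _; move: qyt; rewrite ltr_pdivlMr// => qyt.
  apply: le_trans (ltW qyt); rewrite mulrC ler_wpM2l// lerDl//.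
have h1 := ler_normB (Qp p q) (Qp p q - Qp p y).
have h2 := ler_normD (Qp p q - Qp p y) (Qp p y).
rewrite subKr in h1; rewrite subrK in h2.
by move: h; rewrite le_min => /andP[h3 h4]; apply/andP; split; lra.
Qed.

(** The bounds on [Qp] and its inverse must be exactly [r] and [s^-1], the radii at which the
    majorants are summed. All other constants may be crude and are merged into [l]. *)
Lemma cassini_local_bounds p q e r s : 0 < s -> s < `|Qp p q| < r ->
  exists d l, [/\ 0 < d /\ 0 <= l,
    forall y, ball q d y -> s <= `|Qp p y| <= r,
    lip_on (ball q d) (Qp p) r l /\ lip_on (ball q d) (fun y => (Qp p y)^-1) s^-1 l,
    lip_on (ball q d) (dQp p ^~ e) l l /\ lip_on (ball q d) (dQpV p ^~ e) l l &
    `|2 *: (e * e)| <= l /\ forall y, ball q d y -> `|d2QpV p y e| <= l].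
Proof.
move=> s0 /Qp_near[d d0 dK]; exists d; set K := ball q d.
have idK : bounded_lipschitz K id := bounded_lipschitz_ball q d.
have [l1 l10 QK] := bounded_lipschitz_Qp p idK.
have [l2 l20 dQK] := bounded_lipschitz_dQp p e idK.
have QV y : K y -> Qp p y != 0 /\ `|(Qp p y)^-1| <= s^-1.
  move=> /dK/andP[sy _]; have y0 : 0 < `|Qp p y| by exact: lt_le_trans sy.
  by split; [rewrite -normr_gt0|rewrite normqV lef_pV2].
have VK := lip_onV QV QK.
have blV := lip_on_bounded_lipschitz VK.
have bldQ : bounded_lipschitz K (dQp p ^~ e) by exists l2.
have [l3 l30 dVK] : bounded_lipschitz K (dQpV p ^~ e).
  by apply: bounded_lipschitzN; do 2?apply: bounded_lipschitzM.
have [l4 l40 [d2VK _]] : bounded_lipschitz K (d2QpV p ^~ e).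
  have cK x := bounded_lipschitz_cst K x.
  have -> : d2QpV p ^~ e = (fun y => 2%:A *
     ((Qp p y)^-1 * dQp p y e * (Qp p y)^-1 * dQp p y e * (Qp p y)^-1)
     + - ((Qp p y)^-1 * (2 *: (e * e)) * (Qp p y)^-1)).
    by apply/funext => y; rewrite mulr_algl.
  apply: bounded_lipschitzD; last first.
    apply: bounded_lipschitzN; apply: bounded_lipschitzM => //.
    by apply: bounded_lipschitzM => //; exact: cK.
  apply: bounded_lipschitzM; first exact: cK.
  by do 4![apply: bounded_lipschitzM => //].
have l50 := mulr_ge0 (mulr_ge0 (ltW (_ : 0 < s^-1)) l10) (ltW (_ : 0 < s^-1)).
rewrite invr_gt0 in l50; have {}l50 := l50 s0 s0.
exists (l1 + l2 + l3 + l4 + s^-1 * l1 * s^-1 + `|2 *: (e * e)|).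
have n0 := normr_ge0 (2 *: (e * e)).
split=> //; first by split=> //; rewrite !addr_ge0.
- split; last by apply: lip_on_le VK => //; lra.
  split=> [y /dK/andP[]//|y z Ky Kz]; have [_ Qlip] := QK.
  by apply: le_trans (Qlip y z Ky Kz) _; rewrite ler_wpM2r//; lra.
- by split; [apply: lip_on_le dQK; lra|apply: lip_on_le dVK; lra].
- by split=> [|y /d2VK /le_trans]; [lra|apply; lra].
Qed.

Lemma is_derive_Qp p y e : is_derive y e (Qp p) (dQp p y e).
Proof.
have -> : Qp p = (fun z => z * z) - (fun z => (2 * qre p) *: z) + cst (`|p| ^+ 2)%:A.
  by apply/funext => z; rewrite /Qp expr2.
rewrite -[dQp p y e]addr0 /dQp [y * e + _]addrC.
apply: is_deriveD; apply: is_deriveB; exact: is_derive_mulq.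
Qed.

Lemma is_derive_dQp p y e : is_derive y e (dQp p ^~ e) (2 *: (e * e)).
Proof.
have dl : is_derive y e (fun z => z * e) (e * e + y * 0).
  exact: (is_derive_mulq (f := id) (g := cst e)).
have dr : is_derive y e (fun z => e * z) (0 * y + e * e).
  exact: (is_derive_mulq (f := cst e) (g := id)).
have := is_deriveB (is_deriveD dl dr) (is_derive_cst ((2 * qre p) *: e) y e).
by rewrite mulr0 mul0r addr0 add0r subr0 scaler_nat mulr2n.
Qed.

Lemma is_derive_QpV p y e : Qp p y != 0 ->
  is_derive y e (fun z => (Qp p z)^-1) (dQpV p y e).
Proof. by move=> y0; exact: is_derive_invq (is_derive_Qp p y e). Qed.

Lemma is_derive_dQpV p y e : Qp p y != 0 ->
  is_derive y e (dQpV p ^~ e) (d2QpV p y e).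
Proof.
move=> y0; have dV := is_derive_QpV e y0; have dQ := is_derive_dQp p y e.
have := is_deriveN (is_derive_mulq (is_derive_mulq dV dQ) dV).
congr is_derive; rewrite /d2QpV /dQpV.
move: (Qp p y)^-1 (dQp p y e) (2 *: (e * e)) => V D E.
by rewrite mulrDl !(mulNr, mulrN) !opprD !opprK !mulrA scaler_nat mulr2n addrAC.
Qed.

End CassiniBounds.

Section Summability.
Context {R : realType}.
Local Notation H := (quat R).

Lemma bernoulli_ineq (d : R) n : 0 <= d -> 1 + n%:R * d <= (1 + d) ^+ n.
Proof.
move=> d0; elim: n => [|n IH]; first by rewrite mul0r addr0.
rewrite exprS; apply: le_trans (_ : (1 + d) * (1 + n%:R * d) <= _).
  have := mulr_ge0 (mulr_ge0 d0 d0) (ler0n R n); rewrite -natr1; nra.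
by rewrite ler_wpM2l// addr_ge0.
Qed.

(* Bernoulli's inequality for the powers of [sqrt (rho / r)]. *)
Lemma sqr_pow_le (r rho : R) n : 0 < r -> r < rho ->
  n.+1%:R ^+ 2 * r ^+ n <= (1 + (Num.sqrt (rho / r) - 1)^-1) ^+ 2 * rho ^+ n.
Proof.
move=> r0 rrho; set d := _ - 1.
have d0 : 0 < d.
  have q1 : 1 < rho / r by rewrite ltr_pdivlMr// mul1r.
  by rewrite subr_gt0 -[X in X < _]sqrtr1 ltr_sqrt// (lt_trans _ q1).
have dE : (1 + d) ^+ 2 = rho / r.
  by rewrite /d subrKC sqr_sqrtr// divr_ge0 ?ltW// (lt_trans r0).
clearbody d.
have -> : rho ^+ n = ((1 + d) ^+ n) ^+ 2 * r ^+ n.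
  by rewrite exprAC dE -exprMn divfK// gt_eqF.
rewrite mulrA ler_wpM2r ?exprn_ge0 ?(ltW r0)// -exprMn ler_sqr ?nnegrE; last 2 first.
- by [].
- by rewrite mulr_ge0 ?exprn_ge0 ?addr_ge0 ?invr_ge0 ?(ltW d0).
apply: le_trans (_ : (1 + d^-1) * (1 + n%:R * d) <= _).
  have -> : (1 + d^-1) * (1 + n%:R * d) = 1 + n%:R * d + d^-1 + n%:R.
    by field; rewrite gt_eqF.
  rewrite -natr1.
  have := mulr_ge0 (ler0n R n) (ltW d0); have : 0 <= d^-1 by rewrite invr_ge0 ltW.
  lra.
by rewrite ler_wpM2l ?bernoulli_ineq ?addr_ge0 ?invr_ge0 ?(ltW d0).
Qed.

Lemma cvg_majorant (a c : nat -> H) s (r rho : R) : 0 < r -> r < rho ->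
  cvgn (series (fun n => rho ^+ (s + n) * `|a n|)) ->
  cvgn (series (fun n => rho ^+ (s + n) * `|c n|)) ->
  cvgn (series (majorant r a c s)).
Proof.
move=> r0 rrho ca cc; set k := (1 + (Num.sqrt (rho / r) - 1)^-1) ^+ 2.
have := is_cvg_seriesZ (k := k) (is_cvg_seriesD ca cc).
have k0 : 0 <= k by exact: sqr_ge0.
have rho0 : 0 < rho by exact: lt_trans rrho.
apply: series_le_cvg => n.
- by rewrite !mulr_ge0 ?exprn_ge0 ?addr_ge0// ltW.
- rewrite mulr_ge0//; rewrite addr_ge0 ?mulr_ge0 ?exprn_ge0// ltW//.
have -> : (k *: ((fun n => rho ^+ (s + n) * `|a n|)
    + (fun n => rho ^+ (s + n) * `|c n|))) n
    = k * rho ^+ (s + n) * (`|a n| + `|c n|) by rewrite -mulrA mulrDr.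
by rewrite ler_wpM2r ?addr_ge0// sqr_pow_le.
Qed.

Lemma Qp_norm_surj (p : H) (r : R) : 0 < r -> exists y, `|Qp p y| = r.
Proof.
move=> r0; pose m := qi p ^+ 2 + qj p ^+ 2 + qk p ^+ 2.
have m0 : 0 <= m by rewrite !addr_ge0 ?sqr_ge0.
(* The nonnegative root of [X^2 + 4 m X = r^2]; it will be the square of a real shift of [p]. *)
pose t2 := Num.sqrt (4 * m ^+ 2 + r ^+ 2) - 2 * m.
have rm0 : 0 <= 4 * m ^+ 2 + r ^+ 2 by rewrite addr_ge0 ?sqr_ge0// mulr_ge0 ?sqr_ge0.
have t20 : 0 <= t2.
  rewrite subr_ge0 -(ger0_norm (_ : 0 <= 2 * m)) ?mulr_ge0// -sqrtr_sqr ler_sqrt//.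
  by rewrite exprMn -natrX lerDl sqr_ge0.
have t2E : t2 ^+ 2 + 4 * m * t2 = r ^+ 2.
  have := sqr_sqrtr rm0; rewrite /t2; move: (Num.sqrt _) => z zE.
  by rewrite -[r ^+ 2](addKr (4 * m ^+ 2)) -zE; ring.
(* At [p + t] with [t] real, [Qp p] equals [t ^ 2 + 2 t (vecq p)], whose squared
   norm is [t ^ 4 + 4 m t ^ 2]. *)
exists (p + (Num.sqrt t2)%:A).
have pE : `|p| ^+ 2 = qre p ^+ 2 + m by rewrite normq_sqr /sqnormq /m !addrA.
have tE := sqr_sqrtr t20; move: (Num.sqrt t2) tE => t tE.
have -> : Qp p (p + t%:A) = Quat (t ^+ 2) (2 * t * qi p) (2 * t * qj p) (2 * t * qk p).
  by rewrite /Qp pE /m expr2; apply: quatP => /=; ring.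
rewrite quat_normE /Defs.normq /sqnormq /= -[RHS](ger0_norm (ltW r0)).
rewrite -sqrtr_sqr -t2E -tE.
by congr Num.sqrt; rewrite /m; ring.
Qed.

End Summability.

(** * The Laplacian of the Laurent series *)

Section LaurentLaplacian.
Context {R : realType}.
Local Notation H := (quat R).
Implicit Types (p q x y e : H) (a : int -> H).

(** Common to both halves of the series: [b] is [Qp p] or its inverse, and [k *: X] stands for the
    signed index times the power of [Qp p q] lowered by one. *)
Lemma sum_d2term (b : H -> H) (b1 b2 : H -> H -> H) p q (A C : nat -> H) s n
    (LC CC X : H) (k d : R) :
  \sum_(e <- quat_basis) dpow (b q) (b1 q e) (s + n) * e = - (4 * d) *: LC ->
  \sum_(e <- quat_basis) d2pow (b q) (b1 q e) (b2 q e) (s + n) =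
    - (16 * d ^+ 2) *: CC - 4 *: (k *: X) ->
  \sum_(e <- quat_basis) d2term b (b1 ^~ e) (b2 ^~ e) p A C s e n q =
    - (16 * d ^+ 2) *: (CC * (A n + (q - p) * C n)) - (8 * d) *: (LC * C n)
    - 4 *: (k *: (X * (A n + (q - p) * C n))).
Proof.
move=> h1 h2; rewrite /d2term big_split /= -mulr_suml h2 -scaler_sumr.
under [X in _ + _ *: X = _]eq_bigr do rewrite mulrA.
rewrite -mulr_suml h1; move: (A n + (q - p) * C n) => u; move: (C n) (d ^+ 2) => v c.
rewrite mulrBl -!scalerAl.
by move: (CC * u) (X * u) (LC * v) => x y z; apply: quatP => /=; ring.
Qed.

Definition coef_even a (i : nat -> int) n : H := a (2 * i n).
Definition coef_odd a (i : nat -> int) n : H := a (2 * i n + 1).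

Section Expansion.
Variables (p : H) (R1 R2 : R) (f : H -> H) (a : int -> H).
Hypotheses (R1_gt0 : 0 < R1) (fa : spherical_laurent_expansion f a p R1 R2).

Let Ap := coef_even a Posz.
Let Cp := coef_odd a Posz.
Let An := coef_even a Negz.
Let Cn := coef_odd a Negz.

Lemma laurent_summable t : R1 ^+ 2 < t < R2 ^+ 2 ->
  [/\ cvgn (series (fun n => t ^+ (0 + n) * `|Ap n|)),
      cvgn (series (fun n => t ^+ (0 + n) * `|Cp n|)),
      cvgn (series (fun n => t^-1 ^+ (1 + n) * `|An n|)) &
      cvgn (series (fun n => t^-1 ^+ (1 + n) * `|Cn n|))].
Proof.
move=> /andP[tl tr]; have t0 : 0 < t by rewrite (lt_trans _ tl)// exprn_gt0.
have [y ty] := Qp_norm_surj p t0.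
have sy : cassini_shell p R1 R2 y by rewrite /cassini_shell /= ty tl.
have [_ /(_ y sy)[[h1 h2] [h3 h4]] _] := fa.
(* The odd series carries the factor [y - p], which has to be divided out; [y] differs from [p]
   because [Qp p p = 0] while [t] is positive. *)
have yp : `|y - p| != 0 :> R.
  rewrite normr_eq0 subr_eq0; apply/eqP => yp; move: ty t0.
  have -> : Qp p y = 0.
    by rewrite yp /Qp normq_sqr /sqnormq !expr2; apply: quatP => /=; ring.
  by rewrite normr0 => <-; rewrite ltxx.
have scale (u v : R^nat) : (forall n, u n = `|y - p|^-1 * v n) ->
    cvgn (series v) -> cvgn (series u).
  by move=> uv cv; have -> : u = `|y - p|^-1 *: v; [exact/funext|exact: is_cvg_seriesZ].
have sc (u v : R) : u * v = `|y - p|^-1 * (u * `|y - p| * v) by field.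
have nz n : `|Qp p y ^ Negz n| = t^-1 ^+ (1 + n).
  by rewrite NegzE -exprnN normqV normqX ty exprVn.
split.
- by move: h1; congr (cvgn (series _)); apply/funext => n /=; rewrite normqM normqX ty.
- apply: scale h3 => n /=; rewrite !normqM -exprnP normqX ty; exact: sc.
- by move: h2; congr (cvgn (series _)); apply/funext => n /=; rewrite normqM nz.
- apply: scale h4 => n /=; rewrite !normqM nz; exact: sc.
Qed.

(** Summability is taken halfway towards [R2 ^+ 2] for indices [n >= 0] and halfway towards
    [R1 ^+ 2] for negative ones, where a smaller radius has a larger inverse. The gap pays for the
    quadratic weight. *)
Lemma laurent_majorants t : R1 ^+ 2 < t < R2 ^+ 2 ->
  cvgn (series (majorant t Ap Cp 0)) /\ cvgn (series (majorant t^-1 An Cn 1)).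
Proof.
move=> /andP[tl tr]; have t0 : 0 < t by rewrite (lt_trans _ tl)// exprn_gt0.
have R1t : 0 < R1 ^+ 2 by rewrite exprn_gt0.
split.
  have [|h1 h2 _ _] := @laurent_summable ((t + R2 ^+ 2) / 2); first lra.
  by apply: cvg_majorant h1 h2 => //; lra.
have [|_ _ h1 h2] := @laurent_summable ((t + R1 ^+ 2) / 2); first lra.
apply: cvg_majorant h1 h2; first by rewrite invr_gt0.
by rewrite ltf_pV2 ?posrE; lra.
Qed.

Lemma expansion_eq y : cassini_shell p R1 R2 y ->
  f y = limn (series ((pterm (Qp p) p Ap Cp 0)^~ y))
      + limn (series ((pterm (fun z => (Qp p z)^-1) p An Cn 1)^~ y)).
Proof.
move=> sy; have [/(_ y sy)[_ ->] _ _] := fa; rewrite /zlim; congr (_ + limn (series _)).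
by apply/funext => n; rewrite /pterm /= NegzE -exprnN exprVn.
Qed.

Definition d2pos e :=
  d2term (Qp p) (dQp p ^~ e) (fun=> 2 *: (e * e)) p Ap Cp 0 e.
Definition d2neg e :=
  d2term (fun z => (Qp p z)^-1) (dQpV p ^~ e) (d2QpV p ^~ e) p An Cn 1 e.

Lemma laurent_derive2 q e : `|e| = 1 :> R -> cassini_shell p R1 R2 q ->
  [/\ cvgn (series ((d2pos e)^~ q)), cvgn (series ((d2neg e)^~ q)),
    (\forall x \near q, derivable f x e) &
    is_derive q e ('D_e f)
      (limn (series ((d2pos e)^~ q)) + limn (series ((d2neg e)^~ q)))].
Proof.
move=> e1 /andP[ql qr]; set t := `|Qp p q| in ql qr.
have R1t : 0 < R1 ^+ 2 by rewrite exprn_gt0.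
(* Strictly between [t] and the two ends of the shell: near [q] the norm of [Qp] stays in [[s, r]],
   and the majorants converge at [r] and at [s^-1]. *)
pose r := (t + R2 ^+ 2) / 2; pose s := (t + R1 ^+ 2) / 2.
have s0 : 0 < s by rewrite /s; lra.
have r0 : 0 < r by rewrite /r; lra.
have [|d [l [[d0 l0] dK [QK VK] [dQK dVK] [d2Q d2V]]]] :=
    @cassini_local_bounds _ p q e r s s0.
  by apply/andP; split; rewrite -/t /s /r; lra.
set K := ball q d in dK QK VK dQK dVK d2V.
have oK : open K by exact: ball_open.
have Kq : K q by exact: ballxx.
have shK y : K y -> cassini_shell p R1 R2 y.
  by move=> /dK/andP[sy yr]; apply/andP; split; rewrite /s /r in sy yr; lra.
have Q0 y : K y -> Qp p y != 0.
  by move=> /dK/andP[sy _]; rewrite -normr_gt0; exact: lt_le_trans sy.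
have [|cr _] := @laurent_majorants r; first by rewrite /r; apply/andP; split; lra.
have [|_ cs] := @laurent_majorants s; first by rewrite /s; apply/andP; split; lra.
have Kp y : K y -> `|y - p| <= d + `|q - p|.
  move=> Ky; rewrite -[y - p](subrKA q); apply: le_trans (ler_normD _ _) _.
  by rewrite lerD2r distrC ltW//; move: Ky; rewrite /K -ball_normE.
have rho0 : 0 <= d + `|q - p| by rewrite addr_ge0// ltW.
have Vs0 : 0 < s^-1 by rewrite invr_gt0.
have pos := power_series_derive2 e1 r0 l0 rho0 QK dQK (fun _ _ => d2Q) Kp cr oK
  (fun y _ => is_derive_Qp p y e) (fun y _ => is_derive_dQp p y e).
have neg := power_series_derive2 e1 Vs0 l0 rho0 VK dVK d2V Kp cs oK
  (fun y Ky => is_derive_QpV e (Q0 y Ky)) (fun y Ky => is_derive_dQpV e (Q0 y Ky)).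
have nearK y : K y -> \forall z \near y, K z by move=> Ky; exact: open_nbhs_nbhs.
pose D1 y := limn (series ((dterm (Qp p) (dQp p ^~ e) p Ap Cp 0 e)^~ y))
  + limn (series ((dterm (fun z => (Qp p z)^-1) (dQpV p ^~ e) p An Cn 1 e)^~ y)).
(* The first derivative is needed on the whole ball, so that ['D_e f] coincides with the series [D1]
   near [q] and can be differentiated again. *)
have df y : K y -> is_derive y e f (D1 y).
  move=> Ky; have [_ dp _] := pos y Ky; have [_ dn _] := neg y Ky.
  apply: near_eq_is_derive (is_deriveD dp dn).
  by apply: filterS (nearK y Ky) => z /shK/expansion_eq ->.
have [cp _ dp] := pos q Kq; have [cn _ dn] := neg q Kq; split => //.
  by apply: filterS (nearK q Kq) => y /df[].
apply: near_eq_is_derive (is_deriveD dp dn).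
by apply: filterS (nearK q Kq) => y /df[_ ->].
Qed.

End Expansion.
End LaurentLaplacian.

(** * Linear combinations of sums of series *)

Section SeriesLinearity.
Context {R : realType} {V : normedModType R}.

Lemma lim_series_sum (I : eqType) (s : seq I) (u : I -> nat -> V) :
  (forall i, i \in s -> cvgn (series (u i))) ->
  \sum_(i <- s) limn (series (u i))
  = limn (series (fun n => \sum_(i <- s) u i n)).
Proof.
move=> cu.
suff [] : cvgn (series (fun n => \sum_(i <- s) u i n)) /\
   \sum_(i <- s) limn (series (u i))
   = limn (series (fun n => \sum_(i <- s) u i n)) by [].
elim: s cu => [_|i s IH cu].
  have -> : series (fun n => \sum_(i <- [::]) u i n) = cst 0.
    by apply/funext => n; rewrite /series /= big1// => k _; rewrite big_nil.
  by rewrite big_nil lim_cst; [split=> //; exact: cvg_cst|exact: norm_hausdorff].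
have [|cs sumE] := IH; first by move=> j js; apply: cu; rewrite inE js orbT.
have ci : cvgn (series (u i)) by apply: cu; rewrite inE eqxx.
have -> : (fun n => \sum_(j <- i :: s) u j n)
    = u i + (fun n => \sum_(j <- s) u j n).
  by apply/funext => n; rewrite big_cons.
by split; [rewrite seriesD; exact: is_cvgD|rewrite big_cons sumE seriesD limD].
Qed.

Lemma lim_series_comb (u v w : nat -> V) (x y z : R) :
  cvgn (series u) -> cvgn (series v) -> cvgn (series w) ->
  limn (series (fun n => x *: u n - y *: v n - z *: w n)) =
  x *: limn (series u) - y *: limn (series v) - z *: limn (series w).
Proof.
move=> cu cv cw.
have -> : (fun n => x *: u n - y *: v n - z *: w n) = x *: u - y *: v - z *: w by [].
rewrite !seriesD !seriesN !seriesZ.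
apply: cvg_lim; first exact: norm_hausdorff.
by apply: cvgB; first apply: cvgB; exact: cvgZl_tmp.
Qed.

End SeriesLinearity.

(** * Convergence of the three series of the expansion *)

Section KernelSeries.
Context {R : realType}.
Local Notation H := (quat R).
Implicit Types (p q x y e : H) (a : int -> H).

Lemma norm_basis e : e \in quat_basis -> `|e| = 1 :> R.
Proof.
rewrite !inE => /or4P[] /eqP ->; rewrite ?normq1// quat_normE /Defs.normq /sqnormq /=;
by rewrite !expr0n !expr1n !(addr0, add0r) sqrtr1.
Qed.

Lemma norm_coef_le p q (u v : H) :
  `|u + (q - p) * v| <= (1 + `|q - p|) * (`|u| + `|v|).
Proof.
apply: le_trans (ler_normD _ _) _; rewrite normqM.
have := mulr_ge0 (normr_ge0 (q - p)) (normr_ge0 u).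
have := normr_ge0 v; have := normr_ge0 u; lra.
Qed.

(** The summand 1 takes care of [n = 0], where [n.-1] is still 0. *)
Lemma pow_pred_le (t : R) n : 0 < t -> t ^+ n.-1 <= (1 + t^-1) * t ^+ n.
Proof.
move=> t0; have h : 0 < t^-1 by rewrite invr_gt0.
case: n => [|n]; first by rewrite !expr0 mulr1 lerDl ltW.
have -> : (1 + t^-1) * t ^+ n.+1 = t ^+ n.+1 + t ^+ n.
  by rewrite exprS; field; rewrite gt_eqF.
by rewrite lerDr exprn_ge0// ltW.
Qed.

Lemma cvg_dominated_majorant (u : nat -> H) (t k : R) (b c : nat -> H) s :
  (forall n, `|u n| <=
    k * ((s + n).+1%:R ^+ 2 * t ^+ (s + n)) * (`|b n| + `|c n|)) ->
  cvgn (series (majorant t b c s)) -> cvgn (series u).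
Proof.
move=> uM cM; have := is_cvg_seriesZ (k := k) cM.
apply: cvg_series_dominated => n; apply: le_trans (uM n) _.
by rewrite -mulrA.
Qed.

Section AtPoint.
Variables (p q : H) (a : int -> H).
Hypothesis q0 : Qp p q != 0.
Let t := `|Qp p q|.
Let w := `|(Qp p q)^-1|.
Hypothesis cvgp :
  cvgn (series (majorant t (coef_even a Posz) (coef_odd a Posz) 0)).
Hypothesis cvgn_ :
  cvgn (series (majorant w (coef_even a Negz) (coef_odd a Negz) 1)).

Let t0 : 0 < t. Proof. by rewrite normr_gt0. Qed.
Let k0 : 0 <= 1 + t^-1. Proof. by rewrite addr_ge0 ?invr_ge0// ltW. Qed.

Lemma norm_laurent_coef_le i n :
  `|laurent_coef a p q (i n)| <=
  (1 + `|q - p|) * (`|coef_even a i n| + `|coef_odd a i n|).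
Proof. exact: norm_coef_le. Qed.

(** For [n >= 0] two uses of [pow_pred_le] restore the two missing powers, whence [(1 + t^-1) ^+ 2].
    For [Negz n] the exponent [n.+3] exceeds that of the majorant by two, whence [w ^+ 2]. *)
Lemma zcvg_calC : zcvg (fun n => calC n q p * laurent_coef a p q n).
Proof.
have d0 : 0 <= 1 + `|q - p| by rewrite addr_ge0.
split.
- apply: (cvg_dominated_majorant (k := (1 + t^-1) ^+ 2 * (1 + `|q - p|)) _ cvgp) => n.
  rewrite normqM.
  apply: le_trans (ler_pM _ _ (norm_calC_Posz n q p)
    (norm_laurent_coef_le Posz n)) _ => //.
  rewrite [X in X <= _]mulrA ler_wpM2r ?addr_ge0//.
  rewrite [X in _ <= X]mulrAC ler_wpM2r// mulrCA.
  apply: ler_pM; rewrite ?sqr_ge0 ?exprn_ge0 ?(ltW t0)//.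
    by rewrite ler_sqr ?nnegrE// ler_nat.
  apply: le_trans (pow_pred_le n.-1 t0) _.
  by rewrite expr2 -mulrA ler_wpM2l// pow_pred_le.
- apply: (cvg_dominated_majorant (k := w ^+ 2 * (1 + `|q - p|)) _ cvgn_) => n.
  rewrite normqM.
  apply: le_trans (ler_pM _ _ (norm_calC_Negz n q p)
    (norm_laurent_coef_le Negz n)) _ => //.
  rewrite [X in X <= _]mulrA ler_wpM2r ?addr_ge0//.
  rewrite [X in _ <= X]mulrAC ler_wpM2r// [X in _ <= X]mulrCA -exprD.
  apply: ler_pM; rewrite ?sqr_ge0 ?exprn_ge0//.
  by rewrite ler_sqr ?nnegrE// ler_nat; lia.
Qed.

Lemma zcvg_calL : zcvg (fun n => calL n q p * a (2 * n + 1)).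
Proof.
have le_add (i : nat -> int) n :
  `|a (2 * i n + 1)| <= `|coef_even a i n| + `|coef_odd a i n| by rewrite lerDr.
split.
- apply: (cvg_dominated_majorant (k := 1 + t^-1) _ cvgp) => n; rewrite normqM.
  apply: le_trans (ler_pM _ _ (norm_calL_Posz n q p) (le_add Posz n)) _ => //.
  rewrite ler_wpM2r ?addr_ge0// mulrCA.
  apply: ler_pM; rewrite ?exprn_ge0 ?(ltW t0) ?pow_pred_le//.
  by rewrite -natrX ler_nat; nia.
- apply: (cvg_dominated_majorant (k := w) _ cvgn_) => n; rewrite normqM.
  apply: le_trans (ler_pM _ _ (norm_calL_Negz n q p) (le_add Negz n)) _ => //.
  rewrite ler_wpM2r ?addr_ge0// [X in _ <= X]mulrCA -exprS.
  by apply: ler_pM; rewrite ?exprn_ge0// -natrX ler_nat; nia.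
Qed.

(** At [n = 0] the exponents [-1] and [0] disagree, but both sides carry the scalar 0. *)
Lemma Qp_pred_Posz n :
  (Posz n)%:~R *: (Qp p q ^ (Posz n - 1) * laurent_coef a p q n) =
  n%:R *: (Qp p q ^+ n.-1 * laurent_coef a p q n).
Proof.
case: n => [|n]; first by rewrite !scale0r.
by rewrite (_ : Posz n.+1 - 1 = n); last lia.
Qed.

Lemma Qp_pred_Negz n :
  (Negz n)%:~R *: (Qp p q ^ (Negz n - 1) * laurent_coef a p q (Negz n)) =
  - n.+1%:R *: ((Qp p q)^-1 ^+ n.+2 * laurent_coef a p q (Negz n)).
Proof.
by rewrite (_ : Negz n - 1 = - (n.+2%:Z)); [rewrite -exprnN exprVn NegzE mulrNz|lia].
Qed.

Lemma zcvg_Qp_pred :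
  zcvg (fun n => n%:~R *: (Qp p q ^ (n - 1) * laurent_coef a p q n)).
Proof.
have d0 : 0 <= 1 + `|q - p| by rewrite addr_ge0.
split.
- apply: (cvg_dominated_majorant (k := (1 + t^-1) * (1 + `|q - p|)) _ cvgp) => n.
  rewrite /comp Qp_pred_Posz normrZ normr_nat normqM normqX.
  apply: le_trans (ler_wpM2l _ (ler_wpM2l _ (norm_laurent_coef_le Posz n))) _.
  - by [].
  - by rewrite exprn_ge0.
  rewrite [X in X <= _]mulrA [X in X <= _]mulrA ler_wpM2r ?addr_ge0//.
  rewrite [X in _ <= X]mulrAC ler_wpM2r// [X in _ <= X]mulrCA.
  apply: ler_pM; rewrite ?exprn_ge0 ?(ltW t0) ?pow_pred_le//.
  by rewrite -natrX ler_nat; nia.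
- apply: (cvg_dominated_majorant (k := w * (1 + `|q - p|)) _ cvgn_) => n.
  rewrite /comp Qp_pred_Negz normrZ normrN normr_nat normqM normqX.
  apply: le_trans (ler_wpM2l _ (ler_wpM2l _ (norm_laurent_coef_le Negz n))) _.
  - by [].
  - by rewrite exprn_ge0.
  rewrite [X in X <= _]mulrA [X in X <= _]mulrA ler_wpM2r ?addr_ge0//.
  rewrite [X in _ <= X]mulrAC ler_wpM2r// [X in _ <= X]mulrCA -exprS.
  by apply: ler_pM; rewrite ?exprn_ge0// -natrX ler_nat; nia.
Qed.
End AtPoint.
End KernelSeries.

Unset Implicit Arguments.

Theorem theorem8p12 (R : realType) (p : quat R) (R1 R2 : R)
    (hR1 : 0 < R1) (hR2 : R1 < R2)
    (U : set (quat R)) (openU : open U) (symU : axially_symmetric U)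
    (shellU : cassini_shell p R1 R2 `<=` U)
    (f : quat R -> quat R) (hf : left_slice_hyperholomorphic U f)
    (a : int -> quat R) (hfa : spherical_laurent_expansion f a p R1 R2)
    (q : quat R) (hq : cassini_shell p R1 R2 q) :
  let d := qre q - qre p in
  let SC := fun n : int => calC n q p * laurent_coef a p q n in
  let SL := fun n : int => calL n q p * a (2 * n + 1) in
  let SQ := fun n : int => n%:~R *: (Qp p q ^ (n - 1) * laurent_coef a p q n) in
  has_laplacian f q /\ zcvg SC /\ zcvg SL /\ zcvg SQ /\
  laplacian f q =
    - (16 * d ^+ 2) *: zlim SC - (8 * d) *: zlim SL - 4 *: zlim SQ.
Proof.
move=> d SC SL SQ.
have R10 : 0 < R1 ^+ 2 by rewrite exprn_gt0.
have q0 : Qp p q != 0.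
  by rewrite -normr_gt0; move: hq => /andP[/(lt_trans R10)].
have [cvgp cvgn_] := laurent_majorants hR1 hfa hq.
rewrite -normqV in cvgn_.
have cC := zcvg_calC q0 cvgp cvgn_.
have cL := zcvg_calL q0 cvgp cvgn_.
have cQ := zcvg_Qp_pred q0 cvgp cvgn_.
have D2 e (eb : e \in quat_basis) := laurent_derive2 hR1 hfa (norm_basis eb) hq.
split; first by move=> e /D2[_ _ ? []].
do 3!split=> //.
transitivity (\sum_(e <- quat_basis) (limn (series ((d2pos p a e)^~ q))
    + limn (series ((d2neg p a e)^~ q)))).
  rewrite /laplacian big_seq [RHS]big_seq; apply: eq_bigr => e eb.
  by case: (D2 e eb) => _ _ _ [_ ->].
rewrite big_split /= !lim_series_sum; try by move=> e /D2[].
have [cC1 cC2] := cC; have [cL1 cL2] := cL; have [cQ1 cQ2] := cQ.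
pose part (i : nat -> int) := - (16 * d ^+ 2) *: limn (series (SC \o i))
  - (8 * d) *: limn (series (SL \o i)) - 4 *: limn (series (SQ \o i)).
transitivity (part Posz + part Negz); rewrite /part.
  rewrite -!lim_series_comb//.
  (* The identity holds index by index within each half, so the series are never rearranged. *)
  congr (limn (series _) + limn (series _)); apply/funext => n.
  - have h := sum_dpow_mul p q n; have h2 := sum_d2pow p q n.
    have := sum_d2term p (coef_even a Posz) (coef_odd a Posz) (s := 0) h h2.
    by rewrite /SQ /comp Qp_pred_Posz.
  - have h := sum_dpowV_mul p q n.
    have h2 := sum_d2powV p q n.
    have := @sum_d2term _ (fun z => (Qp p z)^-1) (dQpV p) (d2QpV p) p q
      (coef_even a Negz) (coef_odd a Negz) 1 n _ _ _ _ _ h h2.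
    by rewrite /SQ /comp Qp_pred_Negz.
rewrite /zlim; move: (limn _) (limn _) (limn _) => x1 x2 x3.
move: (limn _) (limn _) (limn _) (d ^+ 2) => x4 x5 x6 c.
by apply: quatP => /=; ring.
Qed.
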